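(* Let the linear model $y=X\beta^\star+\varepsilon$ and the penalty $h$ satisfy assumptions (A1)–(A5) of the context. Then for every $\lambda>0$ the oracle-perturbed convex VAMP fixed-point equations admit a solution: there exist $(\bar\gamma_1,\eta,\tau_1,\tau_2)$ with $0<\bar\gamma_1<\eta$ and $\tau_1,\tau_2\ge0$ such that, with $B^\star\sim\pi$ and $Z\sim N(0,1)$ independent and $S\sim\mu$, $$\frac{\bar\gamma_1}{\eta}=\frac{\bar\gamma_1}{\lambda+\bar\gamma_1}\,\mathbb E\Big[\operatorname{prox}'_{h/(\lambda+\bar\gamma_1)}\Big(B^\star+\frac{\bar\gamma_1}{\lambda+\bar\gamma_1}\sqrt{\tau_1}Z\Big)\Big],$$ $$\tau_2=\Big(\frac{\eta}{\eta-\bar\gamma_1}\Big)^2\Big(\mathbb E\Big[\Big(\operatorname{prox}_{h/(\lambda+\bar\gamma_1)}\Big(B^\star+\frac{\bar\gamma_1}{\lambda+\bar\gamma_1}\sqrt{\tau_1}Z\Big)-B^\star\Big)^2\Big]-\Big(\frac{\bar\gamma_1}{\eta}\Big)^2\tau_1\Big),$$ $$\frac{\bar\gamma_1}{\eta}=1-\frac1\eta G^{-1}\Big(\frac1\eta\Big),$$ $$\tau_1=\Big(\frac{\eta}{\bar\gamma_1}\Big)^2\Big(\mathbb E\Big[\frac{\sigma^2S+(\eta-\bar\gamma_1)^2\tau_2}{(S+\eta-\bar\gamma_1)^2}\Big]-\Big(\frac{\eta-\bar\gamma_1}{\eta}\Big)^2\tau_2\Big).$$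
   Context: **Model.** For each $p$, $n=n(p)$ with $n/p\to\delta\in(0,\infty)$ as $p\to\infty$; $y=X\beta^\star+\varepsilon$ with $X\in\mathbb R^{n\times p}$. $W_2$ is the Wasserstein-2 distance. (A1) $X=U\Sigma V^T$ (SVD) where $V\in\mathbb R^{p\times p}$ is Haar distributed on $O(p)$ and independent of $(U,\Sigma,\beta^\star)$. With $s_{1,p},\dots,s_{p,p}$ the eigenvalues of $X^TX$, $\frac1p\sum_i\delta_{s_{i,p}}$ converges almost surely in $W_2$ to a law $\mu$ compactly supported on $[0,\infty)$ with $\mathbb E_\mu[S]>0$ ($S\sim\mu$), and $\limsup_{p}\max_i s_{i,p}<\infty$ almost surely. (A2) $\varepsilon\sim N(0,\sigma^2I_n)$ with fixed $\sigma^2>0$, independent of $(U,\Sigma,V,\beta^\star)$. (A3) $\frac1p\sum_j\delta_{\beta^\star_j}$ converges almost surely in $W_2$ to some law $\pi$ on $\mathbb R$ with finite second moment; $B^\star\sim\pi$. (A4) $h:\mathbb R\to\mathbb R\cup\{+\infty\}$ is proper, lower semicontinuous, nonconstant and convex, and the set of minimizers of $\frac12\|y-X\beta\|_2^2+\sum_jh(\beta_j)$ is nonempty almost surely for every $p$. (A5) There are at least two distinct points at which $h$ is finite. **Notation.** $\operatorname{prox}_{ah}(y)=\arg\min_{x\in\mathbb R}\{\frac12(x-y)^2+ah(x)\}$ for $a>0$; $\operatorname{prox}'_{ah}$ is its almost-everywhere derivative. $G(c)=\mathbb E_\mu[1/(S+c)]$ for $c>0$, a strictly decreasing bijection from $(0,\infty)$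 onto $(0,\rho_{\max})$, $\rho_{\max}=\mathbb E_\mu[1/S]\in(0,\infty]$ (with $1/0=\infty$); $G^{-1}$ is its inverse. (Only $\mu,\pi,\sigma^2,h,\lambda$ enter the equations.) *)

(* Defs.v *)
From HB Require Import structures.
From mathcomp Require Import all_boot all_order all_algebra.
From mathcomp Require Import all_classical all_reals all_analysis.

Set Implicit Arguments.
Unset Strict Implicit.
Unset Printing Implicit Defensive.
Import Order.TTheory GRing.Theory Num.Theory.
Import numFieldNormedType.Exports.

Local Open Scope classical_set_scope.
Local Open Scope ring_scope.

Section RandomMatrices.
Context {R : realType}.

(* The Borel sigma-algebra for the (finite-dimensional) topology on matrices. *)
Definition borel_mx (m n : nat) : set (set 'M[R]_(m, n)) :=
  <<s [set D : set 'M[R]_(m, n) | open D] >>.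

Definition orthogonal_mx (n : nat) (Q : 'M[R]_n) : Prop := Q *m Q^T = 1%:M.

Definition svd_diagonal (m n : nat) (D : 'M[R]_(m, n)) : Prop :=
  forall (i : 'I_m) (j : 'I_n),
    0 <= D i j /\ (nat_of_ord i <> nat_of_ord j -> D i j = 0).

(* s lists the eigenvalues of A with multiplicity. *)
Definition eigenvalues_of (n : nat) (A : 'M[R]_n) (s : 'I_n -> R) : Prop :=
  char_poly A = \prod_(i < n) ('X - (s i)%:P).

Context {d : measure_display} {T : measurableType d}.

(* The sigma-algebra generated by X. *)
Definition sigma_mx (m n : nat) (X : T -> 'M[R]_(m, n)) : set (set T) :=
  preimage_set_system setT X (@borel_mx m n).

Definition random_mx (m n : nat) (X : T -> 'M[R]_(m, n)) : Prop :=
  sigma_mx X `<=` measurable.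

Variable P : probability T R.

Definition independent (F G : set (set T)) : Prop :=
  forall A B, F A -> G B -> P (A `&` B) = (P A * P B)%E.

(* The law of V is the normalized Haar measure of the compact group O(n),
   i.e. the unique Borel probability on O(n) invariant under left
   translations. *)
Definition haar_distributed (n : nat) (V : T -> 'M[R]_n) : Prop :=
  [/\ random_mx V,
      forall w, orthogonal_mx (V w)
    & forall Q : 'M[R]_n, orthogonal_mx Q ->
        forall D, borel_mx D ->
          P [set w | D (Q *m V w)] = P [set w | D (V w)]].

(* e ~ N(0, v I_n): the joint law is the product of n copies of N(0, v).
   The second parameter of [normal_prob] is the standard deviation. *)
Definition isotropic_gaussian (n : nat) (v : R) (e : T -> 'cV[R]_n) : Prop :=
  random_mx e /\
  forall B : 'I_n -> set R, (forall i, measurable (B i)) ->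
    P [set w | forall i, B i (e w i 0)] =
    (\prod_(i < n) normal_prob 0 (Num.sqrt v) (B i))%E.

End RandomMatrices.

Section Wasserstein.
Context {R : realType}.

Definition empirical (n : nat) (x : 'I_n -> R) : set R -> \bar R :=
  fun A => ((n%:R^-1)%:E * \sum_(i < n) \d_(x i) A)%E.

Definition coupling (m1 m2 : set R -> \bar R)
    (g : probability (measurableTypeR R * measurableTypeR R)%type R) : Prop :=
  forall A : set R, measurable A ->
    g (A `*` setT) = m1 A /\ g (setT `*` A) = m2 A.

Definition wasserstein2 (m1 m2 : set R -> \bar R) : \bar R :=
  (ereal_inf [set (\int[g]_z (((z.1 : R) - z.2) ^+ 2)%:E)%E | g in coupling m1 m2]
     `^ 2^-1)%E.

End Wasserstein.

Section Penalty.
Context {R : realType}.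

Definition proper_efun (h : R -> \bar R) : Prop :=
  (forall x, h x != -oo%E) /\ (exists x, (h x < +oo)%E).

(* If h avoids -oo, the right-hand side is never of the form oo - oo, and
   0 * +oo = 0 makes the cases t = 0 and t = 1 trivial. *)
Definition econvex (h : R -> \bar R) : Prop :=
  forall (x y t : R), 0 <= t <= 1 ->
    (h (t * x + (1 - t) * y)%R <= t%:E * h x + (1 - t)%:E * h y)%E.

Definition penalized_loss (n p : nat) (h : R -> \bar R) (X : 'M[R]_(n, p))
    (y : 'cV[R]_n) (b : 'cV[R]_p) : \bar R :=
  ((2^-1 * \sum_(i < n) ((y - X *m b) i 0) ^+ 2)%:E
   + \sum_(j < p) h (b j 0%R))%E.

Definition prox_objective (a : R) (h : R -> \bar R) (y x : R) : \bar R :=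
  ((2^-1 * (x - y) ^+ 2)%:E + a%:E * h x)%E.

(* The argmin is a singleton when a > 0 and h is proper, lower semicontinuous
   and convex; otherwise the default value 0 may be returned. *)
Definition prox (a : R) (h : R -> \bar R) (y : R) : R :=
  xget 0 [set x : R |
    forall z : R, (prox_objective a h y x <= prox_objective a h y z)%E].

(* [derive1] is total: this is the derivative of the 1-Lipschitz map prox at
   every point of differentiability, hence almost everywhere. *)
Definition prox' (a : R) (h : R -> \bar R) : R -> R := derive1 (prox a h).

End Penalty.

Section FixedPoint.
Context {R : realType}.

(* E[f(B, Z)] for independent B ~ pi and Z ~ N(0, 1). *)
Definition E_BZ (pi : probability (measurableTypeR R) R) (f : R -> R -> R) : R :=
  \int[(pi \x normal_prob (0 : R) 1)%E]_z f z.1 z.2.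

Definition G (mu : probability (measurableTypeR R) R) (c : R) : R := \int[mu]_s ((s : R) + c)^-1.

(* The inverse of the injective map G on (0, oo). Outside of the range of G the
   value is 0, for which g / eta = 1 - Ginv mu eta^-1 / eta forces g = eta. *)
Definition Ginv (mu : probability (measurableTypeR R) R) (v : R) : R :=
  xget 0 [set c : R | 0 < c /\ G mu c = v].

End FixedPoint.

(* Main.v *)
(* Put c = eta - gamma1 and t = gamma1^2 tau1.  The third equation says
   eta = 1/G(c), so gamma1 = 1/G(c) - c, and the fourth one gives tau1 in terms
   of tau2.  With a = 1/(lambda + gamma1) and r = a sqrt t, Gaussian integration
   by parts turns the first equation into
     E[Z prox_{ah}(B + rZ)] = r (1 + (lambda - c) G(c)),
   and eliminating tau2 from the other two leaves, for H(c) = E[1/(S + c)^2],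
     t = sigma^2 (G/H - c) + (1/G^2 - 1/H) E[(prox_{ah}(B + rZ) - B)^2].
   Both sides depend continuously on (c, t), and the Poincare-Miranda theorem on
   a large rectangle solves the system: at c = lambda the right-hand side of the
   first equation is r, which firm nonexpansiveness of prox makes an upper bound
   of the left-hand side; for large c it tends to 0, whereas the left-hand side
   stays positive because prox is not constant.  In the second equation the
   right-hand side is bounded away from 0 for c >= lambda and, up to a multiple
   of the first equation, grows at most like k t with k < 1.  Finally tau2 >= 0 is Bessel's
   inequality E[Z D]^2 <= E[D^2] for D = prox_{ah}(B + rZ) - B. *)
Require Import Defs.
From HB Require Import structures.
From mathcomp Require Import all_boot all_order all_algebra.
From mathcomp Require Import all_classical all_reals all_analysis.
From mathcomp Require Import measurable_realfun ring lra finmap.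

Set Implicit Arguments.
Unset Strict Implicit.
Unset Printing Implicit Defensive.
Import Order.TTheory GRing.Theory Num.Theory.
Import numFieldNormedType.Exports.

Local Open Scope classical_set_scope.
Local Open Scope ring_scope.

(** Why integrate by parts: [prox'] may jump, so continuity of its expectation cannot be read off
    the integrand, whereas E[Z prox] is locally Lipschitz in the parameters. As [prox] is only
    monotone and 1-Lipschitz, the identity is proved through its Stieltjes measure, and with
    nonnegative integrands, so that Tonelli applies before any integrability is known. The price is
    a factor r: at t = 0 both sides of the first equation vanish, so t has to stay away from 0. The
    term sigma^2 (G/H - c) provides this; its lower bound for c >= lambda is where E[S] > 0 enters.
    Growth in t is the other obstacle. E[(prox - B)^2] can be of order r^2 = a^2 t, and the
    coefficient (1/G^2 - 1/H) a^2 may exceed 1. Firm nonexpansiveness gives the sharper leading term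
    r E[Z prox], which on solutions of the first equation is r^2 (1 + (lambda - c) G). The
    coefficient of t is then (gamma1 - (G/H - c)) a <= gamma1 / (lambda + gamma1) <= M / (lambda +
    M) for a bound M of the support of mu; this is the k of the overview. *)

(** * The Poincare-Miranda theorem in the plane *)

(* The parity argument of Sperner's lemma: along each vertical grid line, count
   modulo 2 the edges joining two vertices outside of [a] on which [b] differs.
   The count is odd on the left side and even on the right side. *)
Lemma sperner_square (n : nat) (a b : nat -> nat -> bool) :
  (forall j, a 0%N j = false) -> (forall j, a n j) ->
  (forall i, b i 0%N) -> (forall i, b i n = false) ->
  exists i j, [/\ (i < n)%N, (j < n)%N &
    let c := [:: (i, j); (i.+1, j); (i, j.+1); (i.+1, j.+1)] in
    [/\ has (fun p => a p.1 p.2) c,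
        has (fun p => ~~ a p.1 p.2 && b p.1 p.2) c &
        has (fun p => ~~ a p.1 p.2 && ~~ b p.1 p.2) c]].
Proof.
move=> a0 an b0 bn.
pose e (p q : nat * nat) :=
  [&& ~~ a p.1 p.2, ~~ a q.1 q.2 & b p.1 p.2 (+) b q.1 q.2].
pose sq i j := e (i, j) (i.+1, j) (+) e (i.+1, j) (i.+1, j.+1)
  (+) e (i.+1, j.+1) (i, j.+1) (+) e (i, j.+1) (i, j).
have [/existsP[i /existsP[j sqij]]|/existsPn sq0] :=
    boolP [exists i : 'I_n, [exists j : 'I_n, sq i j]].
  exists i, j; split; [exact: ltn_ord|exact: ltn_ord|].
  move: sqij; rewrite /sq /e /=.
  by do 4![case: (a _ _) => /=]; do 4?[case: (b _ _) => //=].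
pose v i j := e (i, j) (i, j.+1).
pose V i m := \big[addb/false]_(j < m) v i j.
have sq0' i j : (i < n)%N -> (j < n)%N -> sq i j = false.
  move=> lin ljn; have /existsPn/(_ (Ordinal ljn))/negbTE := sq0 (Ordinal lin).
  by [].
have eC p q : e p q = e q p.
  by rewrite /e andbCA; congr [&& _, _ & _]; exact: addbC.
have VV i m : (i < n)%N -> (m <= n)%N ->
    V i m (+) V i.+1 m = e (i, 0%N) (i.+1, 0%N) (+) e (i, m) (i.+1, m).
  move=> lin; elim: m => [|m IH] mn.
    by rewrite /V !big_ord0 !addbb.
  rewrite /V !big_ord_recr /= -/(V i m) -/(V i.+1 m).
  have := IH (ltnW mn); have := sq0' i m lin mn.
  rewrite /sq /v (eC (i, m.+1) (i, m)) (eC (i.+1, m.+1) (i, m.+1)).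
  by do 4![case: (e _ _)]; case: (V _ _); case: (V _ _); case: (e _ _).
have Vconst i : (i <= n)%N -> V i n = V 0%N n.
  elim: i => // i IH lin; rewrite -IH; last exact: ltnW.
  have := VV i n lin (leqnn n).
  rewrite /e /= !b0 !bn !addbb !andbF /=.
  by case: (V _ _); case: (V _ _).
have Vn : V n n = false.
  by rewrite /V big1// => j _; rewrite /v /e /= an.
have V0 : V 0%N n = true.
  have : forall m, V 0%N m = ~~ b 0%N m.
    elim=> [|m IH]; first by rewrite /V big_ord0 b0.
    rewrite /V big_ord_recr /= -/(V 0%N m) IH /v /e /= !a0 /=.
    by case: (b _ _); case: (b _ _).
  by move=> ->; rewrite bn.
by have := Vconst n (leqnn n); rewrite Vn V0.
Qed.

(** Each grid vertex is labelled by the signs of [f] and [g], and the side conditions make the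
    labelling fit [sperner_square]. The resulting cell has a vertex with f > 0, one with g > 0 and
    one with f <= 0 and g <= 0. At a cluster point of such cells, as the mesh tends to 0, continuity
    leaves only f = g = 0. *)
Lemma poincare_miranda (R : realType) (f g : R * R -> R) (a b c d : R) :
  a < b -> c < d ->
  (forall p, a <= p.1 <= b -> c <= p.2 <= d ->
     {for p, continuous f} /\ {for p, continuous g}) ->
  (forall y, c <= y <= d -> f (a, y) <= 0) ->
  (forall y, c <= y <= d -> 0 < f (b, y)) ->
  (forall x, a <= x <= b -> 0 < g (x, c)) ->
  (forall x, a <= x <= b -> g (x, d) <= 0) ->
  exists p, [/\ a <= p.1 <= b, c <= p.2 <= d, f p = 0 & g p = 0].
Proof.
move=> ab cd cfg fa fb gc gd.
(* Past the last index [gr] stays at [w]: [sperner_square] quantifies over all indices, and each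
   must give a point of the rectangle. *)
pose gr (u w : R) n i := if (i <= n.+1)%N then u + (w - u) * (i%:R / n.+1%:R) else w.
have gr0 u w n : gr u w n 0%N = u by rewrite /gr /= mul0r mulr0 addr0.
have grn u w n : gr u w n n.+1 = w.
  by rewrite /gr leqnn divff ?mulr1 ?subrKC// pnatr_eq0.
have grI u w n i : u < w -> u <= gr u w n i <= w.
  move=> uw; rewrite /gr; case: ifPn => [le_in|_]; last by rewrite lexx ltW.
  have i1 : i%:R / n.+1%:R <= 1 :> R.
    by rewrite ler_pdivrMr ?ltr0n// mul1r ler_nat.
  have i0 : 0 <= i%:R / n.+1%:R :> R by rewrite divr_ge0.
  move: i0 i1; set q := i%:R / _ => i0 i1.
  have h1 : 0 <= (w - u) * q by rewrite mulr_ge0// subr_ge0 ltW.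
  have h2 : 0 <= (w - u) * (1 - q) by rewrite mulr_ge0// subr_ge0// ltW.
  by apply/andP; split; lra.
have grS u w n i : (i < n.+1)%N -> u < w ->
    `|gr u w n i - gr u w n i.+1| = (w - u) / n.+1%:R.
  move=> lin uw; rewrite /gr lin (ltnW lin).
  rewrite (_ : _ - _ = - ((w - u) / n.+1%:R)); last first.
    by rewrite -[in X in _ - X]natr1; ring.
  by rewrite normrN ger0_norm// divr_ge0// subr_ge0 ltW.
pose pt n i j := (gr a b n i, gr c d n j).
pose A n i j := (i != 0%N) && ((i == n.+1) || (0 < f (pt n i j))).
pose B n i j := (j != n.+1) && ((j == 0%N) || (0 < g (pt n i j))).
have near_pts n : exists p : R * R, [/\ a <= p.1 <= b, c <= p.2 <= d &
    exists p0 p1 p2 : R * R,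
    [/\ [/\ a <= p0.1 <= b, a <= p1.1 <= b & a <= p2.1 <= b],
        [/\ c <= p0.2 <= d, c <= p1.2 <= d & c <= p2.2 <= d],
        forall q, q \in [:: p0; p1; p2] ->
          `|p.1 - q.1| <= (b - a) / n.+1%:R /\ `|p.2 - q.2| <= (d - c) / n.+1%:R &
        [/\ 0 < f p0, 0 < g p1, f p2 <= 0 & g p2 <= 0]]].
  have [] := @sperner_square n.+1 (A n) (B n).
  - by move=> j; rewrite /A.
  - by move=> j; rewrite /A eqxx.
  - by move=> j; rewrite /B eqxx.
  - by move=> j; rewrite /B eqxx.
  move=> i [j [lin ljn]] [/hasP[q0 q0c Aq0] /hasP[q1 q1c /andP[Aq1 Bq1]]].
  move=> /hasP[q2 q2c /andP[Aq2 Bq2]].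
  have close q : q \in [:: (i, j); (i.+1, j); (i, j.+1); (i.+1, j.+1)] ->
      `|gr a b n i - gr a b n q.1| <= (b - a) / n.+1%:R /\
      `|gr c d n j - gr c d n q.2| <= (d - c) / n.+1%:R.
    have ab0 : 0 <= (b - a) / n.+1%:R by rewrite divr_ge0// subr_ge0 ltW.
    have cd0 : 0 <= (d - c) / n.+1%:R by rewrite divr_ge0// subr_ge0 ltW.
    rewrite !inE => /or4P[]/eqP -> /=;
      by rewrite ?subrr ?normr0 ?(grS a b)// ?(grS c d).
  exists (pt n i j); rewrite /= !grI//; split => //.
  exists (pt n q0.1 q0.2), (pt n q1.1 q1.2), (pt n q2.1 q2.2).
  rewrite /= !grI//; split => //.
    by move=> q; rewrite !inE => /or3P[]/eqP -> /=; exact: close.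
  split.
  - move: Aq0; rewrite /A => /andP[_ /orP[/eqP e|//]].
    by rewrite /pt e grn fb// grI.
  - move: Bq1; rewrite /B => /andP[_ /orP[/eqP e|//]].
    by rewrite /pt e gr0 gc// grI.
  - move: Aq2; rewrite /A negb_and negbK => /orP[/eqP e|].
      by rewrite /pt e gr0 fa// grI.
    by rewrite negb_or -leNgt => /andP[].
  - move: Bq2; rewrite /B negb_and negbK => /orP[/eqP e|].
      by rewrite /pt e grn gd// grI.
    by rewrite negb_or -leNgt => /andP[].
have {near_pts} [u uP] := choice near_pts.
pose K := `[a, b]%classic `*` `[c, d]%classic.
have cK : compact K by apply: compact_setX; exact: segment_compact.
have [p [Kp clp]] : K `&` cluster (u n @[n --> \oo]) !=set0.
  apply: cK; exists 0%N => // n _ /=; have [u1 u2 _] := uP n.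
  by split; rewrite /= in_itv.
have [p1ab p2cd] : a <= p.1 <= b /\ c <= p.2 <= d.
  by case: Kp; rewrite /= !in_itv.
have [cf cg] := cfg p p1ab p2cd.
have key (U : set (R * R)) : nbhs p U -> exists p0 p1 p2 : R * R,
    [/\ U p0, U p1, U p2, 0 < f p0 & [/\ 0 < g p1, f p2 <= 0 & g p2 <= 0]].
  move=> /nbhs_ballP[e /= e0 eU].
  have e20 : 0 < e / 2 by rewrite divr_gt0.
  have lim (w : R) : w / n.+1%:R @[n --> \oo] --> (0 : R).
    rewrite -[X in _ --> X](mulr0 w); apply: cvgM; first exact: cvg_cst.
    exact: cvg_harmonic.
  have small : \forall n \near \oo, (b - a) / n.+1%:R < e / 2 /\ (d - c) / n.+1%:R < e / 2.
    by apply: filterI; [exact: (cvgr_lt _ (lim (b - a)))|exact: (cvgr_lt _ (lim (d - c)))].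
  have [q [[n [s1 s2] <-] [b1 b2]]] := clp
     [set u n | n in [set n | (b - a) / n.+1%:R < e / 2 /\ (d - c) / n.+1%:R < e / 2]]
     (ball p (e / 2)) (filterS (fun n h => ex_intro2 _ _ n h erefl) small)
     (nbhsx_ballx _ _ e20).
  have [_ _ [p0 [p1 [p2 [_ _ cl [? ? ? ?]]]]]] := uP n.
  have U_ w : w \in [:: p0; p1; p2] -> U w.
    move=> /cl[c1 c2]; apply: eU; split.
      by apply: (ball_split (z := (u n).1)) => //=; exact: le_lt_trans c1 _.
    by apply: (ball_split (z := (u n).2)) => //=; exact: le_lt_trans c2 _.
  by exists p0, p1, p2; split => //; apply: U_; rewrite !inE eqxx ?orbT.
exists p; split => //.
- apply/eqP; rewrite eq_le; apply/andP; split; rewrite leNgt; apply/negP => fp.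
  + have [p0 [p1 [p2 [_ _ + _ [_ + _]]]]] := key _ (cvgr_gt _ cf _ fp).
    by move=> /= /lt_le_trans h /h; rewrite ltxx.
  + have [p0 [p1 [p2 [+ _ _ + [_ _ _]]]]] := key _ (cvgr_lt _ cf _ fp).
    by move=> /= /lt_trans h /h; rewrite ltxx.
- apply/eqP; rewrite eq_le; apply/andP; split; rewrite leNgt; apply/negP => gp.
  + have [p0 [p1 [p2 [_ _ + _ [_ _ +]]]]] := key _ (cvgr_gt _ cg _ gp).
    by move=> /= /lt_le_trans h /h; rewrite ltxx.
  + have [p0 [p1 [p2 [_ + _ _ [+ _ _]]]]] := key _ (cvgr_lt _ cg _ gp).
    by move=> /= /lt_trans h /h; rewrite ltxx.
Qed.

(** * Proximal maps *)

Lemma lte_exists_between (R : realFieldType) (x y : \bar R) :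
  (x < y)%E -> exists q : R, (x < q%:E)%E /\ (q%:E < y)%E.
Proof.
move: x y => [x| |] [y| |] //=.
- rewrite lte_fin => xy; exists ((x + y) / 2); rewrite !lte_fin.
  by split; lra.
- by move=> _; exists (x + 1); rewrite lte_fin ltrDl ltr01 ltry.
- by move=> _; exists (y - 1); rewrite lte_fin gtrDl ltrN10 ltNyr.
- by move=> _; exists 0; rewrite ltry ltNyr.
Qed.

(** If the infimum over [K] were not attained, the open sets {F > q} with q above the infimum would
    cover [K], and the least q of a finite subcover would be a lower bound larger than the
    infimum. *)
Lemma lower_semicontinuous_min (R : realType) (F : R -> \bar R) (K : set R) :
  lower_semicontinuous F -> compact K -> K !=set0 ->
  exists2 x, K x & forall z, K z -> (F x <= F z)%E.
Proof.
move=> /lower_semicontinuousP lF; rewrite compact_cover => cK [x0 Kx0].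
pose i := ereal_inf (F @` K).
have [//|nattained] := pselect (exists2 x, K x & forall z, K z -> (F x <= F z)%E).
have iF x : K x -> (i < F x)%E.
  move=> Kx; rewrite ltNge; apply/negP => Fxi; apply: nattained; exists x => // z Kz.
  by apply: (le_trans Fxi); apply: ereal_inf_lbound; exists z.
have [] := cK R [set q | (i < q%:E)%E] (fun q => [set y | (q%:E < F y)%E]).
- by move=> q _; exact: lF.
- move=> x Kx; have [q [iq qF]] := lte_exists_between (iF x Kx).
  by exists q.
move=> D Di DK.
have [q0 [iq0 q0F]] := lte_exists_between (iF x0 Kx0).
(* The seed [q0] keeps the minimum above [i] for any finite family, even an empty one. *)
pose q := \big[Order.min/q0]_(j <- D) j.
have iq : (i < q%:E)%E.
  rewrite /q big_seq; elim/big_ind : _ => // [u w iu iw|j jD].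
    by rewrite minElt; case: ifP.
  by have /set_mem := Di j jD.
have : (q%:E <= i)%E.
  apply: le_ereal_inf_tmp => _ [z Kz <-]; have [j /= jD jF] := DK z Kz.
  apply: le_trans (ltW jF); rewrite lee_fin /q.
  exact: ge_bigmin_seq.
by rewrite leNgt iq.
Qed.

Section Prox.
Context {R : realType}.
Implicit Types (h : R -> \bar R) (a x y z p : R).

Definition closed_convex h :=
  [/\ proper_efun h, lower_semicontinuous h & econvex h].

(** Lower semicontinuity bounds [h] below by its minimum m on [x0 - 1, x0 + 1]. Convexity on the
    segment from x0 to x, evaluated at distance 1 from x0, carries the bound outward with slope k =
    h(x0) - m. This linear control makes the proximal objective coercive. *)
Lemma closed_convex_minorant h x0 : closed_convex h -> (h x0 < +oo)%E ->
  exists2 k, 0 <= k & forall x, ((fine (h x0) - k - k * `|x - x0|)%:E <= h x)%E.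
Proof.
move=> [[hNy _] hlsc hcvx] hx0.
have hx0E : h x0 = (fine (h x0))%:E.
  by rewrite fineK// fin_numE hNy/= lt_eqF.
set h0 := fine (h x0).
have [] := @lower_semicontinuous_min R h `[x0 - 1, x0 + 1] hlsc.
- exact: segment_compact.
- by exists x0; rewrite /= in_itv /=; apply/andP; split; lra.
move=> xm; rewrite /= in_itv /= => /andP[xm1 xm2] xmin.
have hxm0 : (h xm <= h x0)%E.
  by apply: xmin; rewrite /= in_itv /=; apply/andP; split; lra.
have hxmE : h xm = (fine (h xm))%:E.
  by rewrite fineK// fin_numE hNy/= lt_eqF// (le_lt_trans hxm0).
set m := fine (h xm) in hxmE.
have mh0 : m <= h0 by move: hxm0; rewrite hxmE hx0E lee_fin.
exists (h0 - m); first by rewrite subr_ge0.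
move=> x; set k := h0 - m; have k0 : 0 <= k by rewrite subr_ge0.
have [xle|xgt] := leP `|x - x0| 1.
  apply: (@le_trans _ _ m%:E).
    rewrite lee_fin /k; have : 0 <= (h0 - m) * `|x - x0| by rewrite mulr_ge0.
    lra.
  rewrite -hxmE; apply: xmin; rewrite /= in_itv /=.
  by move: xle; rewrite ler_norml => /andP[? ?]; apply/andP; split; lra.
set d : R := `|x - x0| in xgt *.
have d0 : 0 < d by lra.
have [hxy|] := eqVneq (h x) +oo%E; first by rewrite hxy leey.
move=> hxy; have hxE : h x = (fine (h x))%:E.
  by rewrite fineK// fin_numE hNy.
set hx := fine (h x) in hxE.
have := hcvx x x0 d^-1; rewrite hxE hx0E -/h0.
have d01 : 0 <= d^-1 <= 1.
  by rewrite invr_ge0 (ltW d0)/= invf_le1// ltW.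
move=> /(_ d01).
have : (m%:E <= h (d^-1 * x + (1 - d^-1) * x0)%R)%E.
  rewrite -hxmE; apply: xmin; rewrite /= in_itv /=.
  have -> : d^-1 * x + (1 - d^-1) * x0 = x0 + d^-1 * (x - x0) by ring.
  have : `|d^-1 * (x - x0)| <= 1.
    by rewrite normrM ger0_norm ?invr_ge0 ?(ltW d0)// -/d mulVf// gt_eqF.
  by rewrite ler_norml => /andP[? ?]; apply/andP; split; lra.
move=> /le_trans h1 /h1{h1}; rewrite -!EFinM -EFinD !lee_fin => h1.
have : d * m <= hx + (d - 1) * h0.
  have := ler_wpM2l (ltW d0) h1.
  by rewrite (_ : d * (_ + _) = hx + (d - 1) * h0)//; field; rewrite gt_eqF.
rewrite /k; lra.
Qed.

Lemma lower_semicontinuous_prox_objective h a y : proper_efun h ->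
  lower_semicontinuous h -> 0 < a -> lower_semicontinuous (prox_objective a h y).
Proof.
move=> [hNy _] hlsc a0 x l; rewrite /prox_objective.
have [hxy _|hxy] := eqVneq (h x) +oo%E.
  have [|V xV VP] := hlsc x (l / a); first by rewrite hxy ltry.
  exists V => // z /VP lz.
  have : (l%:E < a%:E * h z)%E.
    move: lz; case: (h z) => [r||] //=; last by move=> _; rewrite gt0_muley ?lte_fin ?ltry.
    by rewrite -EFinM !lte_fin ltr_pdivrMr// mulrC.
  move=> /lt_le_trans; apply; rewrite leeDr// lee_fin.
  by rewrite mulr_ge0// sqr_ge0.
have hxE : h x = (fine (h x))%:E by rewrite fineK// fin_numE hNy.
rewrite hxE -EFinM -EFinD lte_fin; set q := fun z => 2^-1 * (z - y) ^+ 2.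
rewrite -/(q x) => lx.
pose e := (q x + a * fine (h x) - l) / 4.
have e0 : 0 < e by rewrite divr_gt0// subr_gt0.
have cq : {for x, continuous q}.
  by apply: cvgM; [exact: cvg_cst|apply: cvgM; (apply: cvgB; [exact: cvg_id|exact: cvg_cst])].
have [|V xV VP] := hlsc x (fine (h x) - e / a).
  by rewrite [ltRHS]hxE lte_fin gtrBl divr_gt0.
exists (V `&` [set z | q x - e < q z]).
  apply: filterI => //; apply: (cvgr_gt _ cq); lra.
move=> z [/VP lz /= qz].
have : ((a * fine (h x) - e)%:E < a%:E * h z)%E.
  move: lz; case: (h z) => [r||] //=; last by move=> _; rewrite gt0_muley ?lte_fin ?ltry.
  rewrite -EFinM !lte_fin => hr; have aE : a * (e / a) = e.
    by rewrite mulrC divfK// gt_eqF.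
  have : 0 < a * (r - (fine (h x) - e / a)) by rewrite mulr_gt0// subr_gt0.
  by rewrite mulrBr mulrBr aE; lra.
move=> lz'; apply: (@lt_trans _ _ ((q x - e) + (a * fine (h x) - e))%:E).
  by rewrite lte_fin /e; lra.
by rewrite EFinD; apply: lteD => //; rewrite lte_fin.
Qed.

(** The quadratic term beats the minorant of linear growth: far from a point x0 of the domain the
    objective exceeds its value at x0, so a minimum over a large segment is global and the default
    value of [prox] is never taken. *)
Lemma prox_min h a y : closed_convex h -> 0 < a ->
  forall z, (prox_objective a h y (prox a h y) <= prox_objective a h y z)%E.
Proof.
move=> hcc a0; apply: (@xgetPex _ 0 [set x | forall z, (prox_objective a h y x <= _ z)%E]).
have [[hNy [x0 hx0]] hlsc hcvx] := hcc.
have [k k0 kP] := closed_convex_minorant hcc hx0.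
have hx0E : h x0 = (fine (h x0))%:E by rewrite fineK// fin_numE hNy/= lt_eqF.
set h0 := fine (h x0) in kP hx0E.
(* At distance d > rho from x0, half of d^2 dominates the cross term d |x0 - y| and the loss a k d,
   and leaves d over, which absorbs a k. *)
pose rho := 2 * (`|x0 - y| + a * k + 1).
have ak0 : 0 <= a * k by rewrite mulr_ge0// ltW.
have rho0 : 0 < rho by rewrite /rho; have := normr_ge0 (x0 - y); lra.
have lF := @lower_semicontinuous_prox_objective h a y (conj hNy (ex_intro _ x0 hx0)) hlsc a0.
have [] := lower_semicontinuous_min lF (@segment_compact _ (x0 - rho) (x0 + rho)).
  by exists x0; rewrite /= in_itv /=; apply/andP; split; lra.
move=> x _ xP; exists x => z.
have [zin|zout] := leP `|z - x0| rho.
  apply: xP; rewrite /= in_itv /=.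
  by move: zin; rewrite ler_norml => /andP[? ?]; apply/andP; split; lra.
apply: (@le_trans _ _ (prox_objective a h y x0)).
  by apply: xP; rewrite /= in_itv /=; apply/andP; split; lra.
rewrite /prox_objective hx0E -EFinM -EFinD.
set d : R := `|z - x0| in zout.
apply: (@le_trans _ _ (2^-1 * (z - y) ^+ 2 + a * (h0 - k - k * d))%:E); last first.
  by rewrite EFinD leeD2l// EFinM; apply: lee_wpmul2l; [rewrite lee_fin ltW|exact: kP].
rewrite lee_fin.
have dd : d ^+ 2 = (z - x0) ^+ 2 by rewrite /d real_normK// num_real.
have h1 : - (d * `|x0 - y|) <= (z - x0) * (x0 - y).
  by rewrite /d -normrM lerNl -normrN ler_norm.
have h2 : rho * d <= d ^+ 2 by rewrite expr2; apply: ler_wpM2r; [exact: normr_ge0|exact: ltW].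
have h3 : a * k <= d by move: zout; rewrite /rho; have := normr_ge0 (x0 - y); lra.
have -> : (z - y) ^+ 2 = d ^+ 2 + 2 * ((z - x0) * (x0 - y)) + (x0 - y) ^+ 2.
  by rewrite dd; ring.
move: h2; rewrite /rho.
have : 0 <= a * k * d by apply: mulr_ge0 => //; exact: normr_ge0.
have : 0 < d by apply: lt_trans zout.
lra.
Qed.

Lemma prox_fin_num h a y : closed_convex h -> 0 < a -> h (prox a h y) \is a fin_num.
Proof.
move=> hcc a0; have := prox_min y hcc a0; have [[hNy [x0 hx0]] _ _] := hcc.
move=> /(_ x0); rewrite /prox_objective fin_numE hNy /=.
have hx0E : h x0 = (fine (h x0))%:E by rewrite fineK// fin_numE hNy/= lt_eqF.
rewrite hx0E -EFinM -EFinD.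
by case: (h (prox a h y)) => //=; rewrite gt0_muley ?lte_fin.
Qed.

(** First-order optimality: (y - p) / a is a subgradient of [h] at the minimiser p, as seen by
    comparing p with p + t (x - p) for small t. *)
Lemma prox_variational h a y x : closed_convex h -> 0 < a -> (h x < +oo)%E ->
  (y - prox a h y) * (x - prox a h y) <= a * (fine (h x) - fine (h (prox a h y))).
Proof.
move=> hcc a0 hx; have hp := prox_fin_num y hcc a0.
have pmin := prox_min y hcc a0; have [[hNy _] _ hcvx] := hcc.
move: hp pmin; set p := prox a h y => hp pmin.
have hxE : h x = (fine (h x))%:E by rewrite fineK// fin_numE hNy/= lt_eqF.
have hpE : h p = (fine (h p))%:E by rewrite fineK.
set hx' := fine (h x) in hxE *; set hp' := fine (h p) in hpE *.
rewrite leNgt; apply/negP => lt0.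
pose E := (y - p) * (x - p) - a * (hx' - hp').
have E0 : 0 < E by rewrite subr_gt0.
(* Small enough that the quadratic term t^2 (x - p)^2 / 2 stays below the first-order gain t E; the
   added 1 keeps the denominator positive. *)
pose t := Num.min 1 (E / ((x - p) ^+ 2 + 1)).
have q0 : 0 < (x - p) ^+ 2 + 1 by rewrite ltr_wpDl// sqr_ge0.
have t0 : 0 < t by rewrite /t lt_min ltr01 divr_gt0.
have t1 : t <= 1 by rewrite /t ge_min lexx.
have tE : t * ((x - p) ^+ 2 + 1) <= E by rewrite -ler_pdivlMr// /t ge_min lexx orbT.
have := pmin (t * x + (1 - t) * p); rewrite /prox_objective.
have := hcvx x p t; rewrite (ltW t0) t1 => /(_ erefl) cvx.
have a0e : (0%:E <= a%:E)%E by rewrite lee_fin ltW.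
move=> /le_trans /(_ (leeD2l _ (lee_wpmul2l a0e cvx))).
rewrite hxE hpE -!EFinM -!EFinD lee_fin.
have -> : t * x + (1 - t) * p - y = (p - y) + t * (x - p) by ring.
move=> H.
have : 0 <= t * (2^-1 * (t * (x - p) ^+ 2) - E).
  rewrite /E; rewrite -subr_ge0 in H; apply: le_trans H _.
  by rewrite le_eqVlt; apply/orP; left; apply/eqP; field.
rewrite pmulr_rge0// => ?.
have : 0 <= t * (x - p) ^+ 2 by rewrite mulr_ge0// ?sqr_ge0// ltW.
lra.
Qed.

(** Monotonicity of the subdifferential, from the sum of two instances of [prox_variational]. Two
    different steps are kept because equal steps give firm nonexpansiveness and equal arguments give
    the dependence on the step. *)
Lemma prox_resolvent_monotone h a1 a2 y1 y2 : closed_convex h -> 0 < a1 -> 0 < a2 ->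
  (prox a2 h y2 - prox a1 h y1) *
    ((y1 - prox a1 h y1) / a1 - (y2 - prox a2 h y2) / a2) <= 0.
Proof.
move=> hcc a10 a20.
have lty a y : 0 < a -> (h (prox a h y) < +oo)%E.
  by move=> a0; rewrite ltey_eq prox_fin_num.
have := prox_variational y1 hcc a10 (lty _ y2 a20).
have := prox_variational y2 hcc a20 (lty _ y1 a10).
set p1 := prox a1 h y1; set p2 := prox a2 h y2.
rewrite -!ler_pdivrMl// => H1 H2.
move: (lerD H1 H2); rewrite [leRHS](_ : _ = 0); last by ring.
apply: le_trans; rewrite le_eqVlt; apply/orP; left; apply/eqP; ring.
Qed.

Lemma prox_firmly_nonexpansive h a y1 y2 : closed_convex h -> 0 < a ->
  (prox a h y2 - prox a h y1) ^+ 2 <= (prox a h y2 - prox a h y1) * (y2 - y1).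
Proof.
move=> hcc a0; have := prox_resolvent_monotone y1 y2 hcc a0 a0.
rewrite -mulrBl mulrA pmulr_lle0 ?invr_gt0// => H.
rewrite -subr_le0; apply: le_trans H; rewrite le_eqVlt; apply/orP; left; apply/eqP; ring.
Qed.

Lemma prox_homo h a y1 y2 : closed_convex h -> 0 < a -> y1 <= y2 ->
  prox a h y1 <= prox a h y2.
Proof.
move=> hcc a0 y12; have := prox_firmly_nonexpansive y1 y2 hcc a0.
set u := prox a h y1; set v := prox a h y2 => H.
have [//|lt12] := leP u v; exfalso; move: H.
have : 0 < (v - u) ^+ 2 by rewrite exprn_even_gt0//= subr_eq0 lt_eqF.
have : (v - u) * (y2 - y1) <= 0 by rewrite mulr_le0_ge0// ?subr_ge0// subr_le0 ltW.
lra.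
Qed.

Lemma prox_ler_sub h a y1 y2 : closed_convex h -> 0 < a -> y1 <= y2 ->
  prox a h y2 - prox a h y1 <= y2 - y1.
Proof.
move=> hcc a0 y12; have := prox_firmly_nonexpansive y1 y2 hcc a0.
have := prox_homo hcc a0 y12; rewrite -subr_ge0 le_eqVlt => /predU1P[<-|lt0].
  by rewrite subr_ge0.
by rewrite expr2 ler_pM2l.
Qed.

Lemma prox_nonexpansive h a y1 y2 : closed_convex h -> 0 < a ->
  `|prox a h y2 - prox a h y1| <= `|y2 - y1|.
Proof.
move=> hcc a0; wlog y12 : y1 y2 / y1 <= y2.
  by move=> W; case: (leP y1 y2) => [/W//|/ltW /W]; rewrite distrC (distrC y1).
by rewrite !ger0_norm ?subr_ge0 ?prox_ler_sub// prox_homo.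
Qed.

Lemma prox_scale_lipschitz h a1 a2 y : closed_convex h -> 0 < a1 -> 0 < a2 ->
  `|prox a2 h y - prox a1 h y| <= `|y - prox a1 h y| * (`|a2 - a1| / a1).
Proof.
move=> hcc a10 a20; have := prox_resolvent_monotone y y hcc a10 a20.
set p1 := prox a1 h y; set p2 := prox a2 h y => H.
have {}H : (p2 - p1) ^+ 2 <= (p2 - p1) * (y - p1) * ((a1 - a2) / a1).
  have : a2 * ((p2 - p1) * ((y - p1) / a1 - (y - p2) / a2)) <= 0.
    by rewrite pmulr_rle0.
  rewrite (_ : a2 * _ = (p2 - p1) ^+ 2 - (p2 - p1) * (y - p1) * ((a1 - a2) / a1)).
    by rewrite subr_le0.
  by field; rewrite !gt_eqF.
have {}H : `|p2 - p1| ^+ 2 <= `|p2 - p1| * (`|y - p1| * (`|a2 - a1| / a1)).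
  rewrite real_normK ?num_real//; apply: (le_trans H); apply: (le_trans (ler_norm _)).
  by rewrite !normrM (distrC a1) normfV (gtr0_norm a10) !mulrA.
have [->|p0] := eqVneq (p2 - p1) 0.
  by rewrite normr0 !mulr_ge0// invr_ge0 ltW.
by move: H; rewrite expr2 ler_pM2l// normr_gt0.
Qed.

(** If [prox] were constantly p, then [prox_variational] at a point x of the domain other than p
    would bound (y - p)(x - p) over all y. The two points of the domain provide such an x. *)
Lemma prox_nonconstant h a : closed_convex h -> 0 < a ->
  (exists x1 x2, [/\ x1 != x2, (h x1 < +oo)%E & (h x2 < +oo)%E]) ->
  exists y1 y2, prox a h y1 != prox a h y2.
Proof.
move=> hcc a0 [x1 [x2 [x12 hx1 hx2]]].
have [//|cst] := pselect (exists y1 y2, prox a h y1 != prox a h y2).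
pose p := prox a h 0.
have pE y : prox a h y = p.
  by apply/eqP/negPn/negP => ne; apply: cst; exists y, 0.
have [x xp hx] : exists2 x, x != p & (h x < +oo)%E.
  have [x1p|] := eqVneq x1 p; last by exists x1.
  by exists x2 => //; rewrite -x1p eq_sym.
pose C := a * (fine (h x) - fine (h p)).
have := prox_variational (p + (C + 1) / (x - p)) hcc a0 hx.
rewrite pE -/C (_ : _ * _ = C + 1); first by lra.
by field; rewrite subr_eq0.
Qed.

End Prox.

(** * Derivatives of nonexpansive functions *)

(** By the Cauchy criterion the set E of differentiability points is built from the closed sets C k
    m, on which quotients with increments below 1/(m+1) differ by at most 1/(k+1). On E the
    derivative is the limit of the quotients along 1/(n+1); off E it is the default [point]. *)
Lemma measurable_derive1 (R : realType) (f : R -> R) :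
  continuous f -> measurable_fun setT (derive1 f).
Proof.
move=> cf; pose Q (h x : R) := h^-1 *: (f (h + x) - f x).
pose C (k m : nat) := \bigcap_(pq in [set pq : R * R |
    0 < `|pq.1| < m.+1%:R^-1 /\ 0 < `|pq.2| < m.+1%:R^-1])
  [set x | `|Q pq.1 x - Q pq.2 x| <= k.+1%:R^-1].
have cQ h : continuous (Q h).
  move=> x; apply: cvgZr; apply: cvgB; last exact: cf.
  apply: (@continuous_comp _ _ _ (fun x => h + x) f); last exact: cf.
  by apply: cvgD; [exact: cvg_cst|exact: cvg_id].
have mC k m : measurable (C k m).
  apply: closed_measurable; apply: closed_bigI => pq _.
  apply: (@closed_comp _ _ (fun x => `|Q pq.1 x - Q pq.2 x|) [set y | y <= k.+1%:R^-1]).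
    by move=> x _; apply: cvg_norm; apply: cvgB; exact: cQ.
  exact: closed_le.
pose E := \bigcap_k \bigcup_m C k m.
have mE : measurable E.
  by apply: bigcap_measurable => // k _; apply: bigcup_measurable => m _.
have cvE x : E x <-> cvg (Q ^~ x @ 0^').
  split=> [Ex|].
    apply: cauchy_cvg; apply/cauchy_ballP => e e0.
    have [k ke] := ltr_add_invr e0; rewrite add0r in ke.
    have [m _ Cm] := Ex k I.
    have nb : \forall p \near (0 : R)^', 0 < `|p| < m.+1%:R^-1.
      near=> p; rewrite normr_gt0; apply/andP; split.
        by near: p; exact: nbhs_dnbhs_neq.
      by near: p; apply: dnbhs0_lt; rewrite invr_gt0.
    have {}nb : \forall p \near (0 : R)^' & q \near (0 : R)^',
        ball (Q p x) e (Q q x).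
      exists ([set p : R | 0 < `|p| < m.+1%:R^-1], [set p : R | 0 < `|p| < m.+1%:R^-1]) => //.
      move=> [p q] /= [pm qm].
      by apply: le_lt_trans ke; exact: (Cm (p, q)).
    rewrite near_map2; exact: nb.
  move=> /cauchy_cvgP /cauchy_ballP cc k _.
  have /cc : 0 < k.+1%:R^-1 :> R by rewrite invr_gt0.
  rewrite near_map2 => -[[A B] /= [/nbhs_ballP[a /= a0 aA] /nbhs_ballP[b /= b0 bB]]] AB.
  have [m mab] : exists m : nat, m.+1%:R^-1 < Num.min a b.
    have ab0 : 0 < Num.min a b by rewrite lt_min a0.
    by have [m] := ltr_add_invr ab0; rewrite add0r => ?; exists m.
  exists m => // -[p q] /= [/andP[p0 pm] /andP[q0 qm]].
  apply: ltW; apply: (AB (p, q)); split.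
    apply: aA; last by rewrite -normr_gt0.
    by rewrite /ball /= sub0r normrN (lt_trans pm)// (lt_le_trans mab)// ge_min lexx.
  apply: bB; last by rewrite -normr_gt0.
  by rewrite /ball /= sub0r normrN (lt_trans qm)// (lt_le_trans mab)// ge_min lexx orbT.
apply: (@measurable_fun_cvg _ _ _ setT
  (fun n x => if x \in E then Q n.+1%:R^-1 x else point)) => [n|x _].
  apply: measurable_fun_ifT => //.
    by apply: (measurable_fun_bool true); rewrite setTI preimage_mem_true.
  by apply: continuous_measurable_fun; exact: cQ.
have [Ex|nEx] := boolP (x \in E); last first.
  rewrite (_ : derive1 f x = point); first exact: cvg_cst.
  rewrite /derive1 dvgP//.
  by move=> /cvE /mem_set; apply/negP.
have /cvE /cvg_ex[l Ql] := set_mem Ex.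
have -> : derive1 f x = l by apply/cvg_lim.
have /cvgr_dnbhsP := Ql.
apply; split => [n|].
  by rewrite invr_neq0.
exact: cvg_harmonic.
Unshelve. all: by end_near. Qed.

Section Nonexpansive.
Context {R : realType}.
Notation mu := (@lebesgue_measure R).

Lemma lebesgue_stieltjes_measure_itvoc (F : cumulative R R) (a b : R) : a <= b ->
  lebesgue_stieltjes_measure F `]a, b] = (F b - F a)%:E.
Proof.
move=> ab; rewrite /lebesgue_stieltjes_measure /measure_extension.
rewrite measurable_mu_extE/=; last exact: is_ocitv.
by rewrite wlength_itv_bnd.
Qed.

(** The function x - F x is nondecreasing as well, and its Stieltjes measure added to that of [F] is
    Lebesgue measure, by uniqueness on half-open intervals. *)
Lemma lebesgue_stieltjes_measure_le (F : cumulative R R) (A : set R) :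
  continuous F -> (forall x y, x <= y -> F y - F x <= y - x) -> measurable A ->
  (lebesgue_stieltjes_measure F A <= mu A)%E.
Proof.
move=> cF lF mA; pose g x := x - F x.
have ndg : {homo g : x y / x <= y}.
  by move=> x y xy; rewrite /g; have := lF x y xy; lra.
have rcg : right_continuous g.
  apply: right_continuousW => x; apply: cvgB; [exact: cvg_id|exact: cF].
pose G : cumulative R R := HB.pack g (isCumulative.Build R _ R g ndg rcg).
rewrite (@lebesgue_measure_unique R
  (measure_add (lebesgue_stieltjes_measure F) (lebesgue_stieltjes_measure G)) _ A mA).
  by rewrite [leRHS]measure_addE leeDl.
move=> X /ocitvP[->|[[a b] /= ab ->]]; first by rewrite !measure0.
rewrite [RHS]measure_addE /= !lebesgue_stieltjes_measure_itvoc ?ltW//.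
rewrite lebesgue_measure_itv /= lte_fin ab -!EFinD; congr EFin.
by rewrite /= /g; ring.
Qed.

Variable f : R -> R.
Hypothesis ndf : {homo f : x y / x <= y}.
Hypothesis lipf : forall x y, x <= y -> f y - f x <= y - x.

Lemma nonexpansive_continuous : continuous f.
Proof.
move=> x; apply/cvgrPdist_le => e e0; near=> y.
have xy : `|x - y| <= e by near: y; apply: cvgr_dist_le => //; exact: cvg_id.
apply: le_trans xy; case: (leP x y) => [xy|/ltW yx].
  by rewrite !ler0_norm ?subr_le0 ?ndf// !opprB lipf.
by rewrite !ger0_norm ?subr_ge0 ?ndf// lipf.
Unshelve. all: by end_near. Qed.

Lemma derive1_nonexpansive_ge0 x : 0 <= derive1 f x.
Proof.
rewrite /derive1; have [|ncv] := pselect (cvg (h^-1 *: (f (h + x) - f x) @[h --> 0^'])).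
  move=> cv; apply: limr_ge => //; near=> h.
  have [h0|h0] := leP 0 h.
    by apply: mulr_ge0; rewrite ?invr_ge0// subr_ge0; apply: ndf; rewrite lerDr.
  apply: mulr_le0; first by rewrite invr_le0 ltW.
  by rewrite subr_le0; apply: ndf; rewrite gerDr ltW.
by rewrite dvgP.
Unshelve. all: by end_near. Qed.

(** The Stieltjes measure of [f] is dominated by Lebesgue measure, so it has a density by
    Radon-Nikodym, and Lebesgue differentiation identifies this density with the derivative almost
    everywhere. *)
Lemma integral_derive1_nonexpansive (u v : R) : u <= v ->
  (\int[mu]_(x in `]u, v]) (derive1 f x)%:E = (f v - f u)%:E)%E.
Proof.
rewrite le_eqVlt => /predU1P[->|uv].
  by rewrite set_itvoc0 ?integral_set0 ?subrr.
have rcf : right_continuous f by apply: right_continuousW; exact: nonexpansive_continuous.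
pose F : cumulative R R := HB.pack f (isCumulative.Build R _ R f ndf rcf).
have mD : measurable (`]u, v] : set (measurableTypeR R)) by exact: measurable_itv.
have Doo : (lebesgue_stieltjes_measure F `]u, v] < +oo)%E.
  by rewrite lebesgue_stieltjes_measure_itvoc ?ltW// ltry.
pose nu : {finite_measure set (measurableTypeR R) -> \bar R} := mfrestr mD Doo.
have [|rho [rho0 rhofin irho nuE]] := @radon_nikodym_sigma_finite _ _ R mu nu.
  apply/null_content_dominatesP => A mA A0; apply/eqP; rewrite -measure_le0 /=.
  rewrite /mfrestr /mrestr -A0.
  apply: le_trans (lebesgue_stieltjes_measure_le (F := F) _ lipf mA).
    by apply: le_measure; [apply/mem_set/measurableI|exact/mem_set|exact: subIsetl].
  exact: nonexpansive_continuous.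
pose r x := fine (rho x).
have rE x : rho x = (r x)%:E by rewrite fineK.
have ir : mu.-integrable setT (EFin \o r).
  by apply: eq_integrable irho => // x _; rewrite rE.
have fE x : u < x -> x <= v -> (\int[mu]_(t in `]u, x]) r t = f x - f u)%R.
  move=> ux xv; rewrite /Rintegral.
  under eq_integral do rewrite -rE.
  rewrite -nuE//= /mfrestr /mrestr setIidl; last exact: subset_itvl.
  by rewrite lebesgue_stieltjes_measure_itvoc ?ltW.
have aer : {ae mu, forall x, x \in `]u, v] -> (derive1 f x)%:E = (r x)%:E}.
  have mr : measurable_fun setT r by apply/measurable_EFinP; exact: measurable_int ir.
  have locr : locally_integrable setT r.
    by apply: open_integrable_locally => //; exact: openT.
  have ftc : {ae mu, forall x, u < x ->
      derivable (fun x => \int[mu]_(t in `]u, x]) r t) x 1 /\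
      derive1 (fun x => \int[mu]_(t in `]u, x]) r t) x = r x}.
    have irS y : mu.-integrable `]u, y] (EFin \o r).
      by apply: integrableS ir => //; exact: measurable_itv.
    have := @FTC1 R r (BRight u) irS locr.
    apply: filterS; first exact: (ae_filter_ringOfSetsType mu).
    by move=> x /= H ux; apply: H.
  (* At v the formula [fE] is known only on the left, so the derivative cannot be read off there;
     one point is negligible. *)
  have aev : {ae mu, forall x : R, x != v}.
    exists [set v]; split => //; first exact: lebesgue_measure_set1.
    by move=> x /= /negP; rewrite negbK => /eqP.
  apply: filterS2 ftc aev; first exact: (ae_filter_ringOfSetsType mu).
  move=> x /= ftc xv; rewrite in_itv /= => /andP[ux xlev].
  have {xlev} xv : x < v by rewrite lt_neqAle xv.
  have [dF <-] := ftc ux; congr EFin; rewrite !derive1E.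
  rewrite (near_eq_derive (g := fun x => \int[mu]_(t in `]u, x]) r t + f u)).
    by rewrite deriveD// derive_cst addr0.
  near=> y; rewrite fE ?subrK//; near: y.
    exact: lt_nbhsr.
  by apply: filterS (lt_nbhsl xv) => z /ltW.
rewrite (ae_eq_integral (EFin \o r))//.
- rewrite -(fE v uv (lexx v)) /Rintegral fineK//.
  by apply: integrable_fin_num => //; exact: integrableS ir.
- apply/measurable_EFinP; apply: (measurable_funS measurableT) => //.
  by apply: measurable_derive1; exact: nonexpansive_continuous.
- by apply: (measurable_funS measurableT) => //; exact: measurable_int ir.
Unshelve. all: by end_near. Qed.

End Nonexpansive.

(** * Gaussian integration by parts *)

Section Gaussian.
Context {R : realType}.
Notation mu := (@lebesgue_measure R).
Notation phi := (@normal_pdf R 0 1).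
Notation N01 := (@normal_prob R 0 1).

Lemma normal01_pdfE x : phi x = normal_peak 1 * expR (- (x ^+ 2 / 2)).
Proof.
rewrite normal_pdfE ?oner_neq0// /normal_fun subr0 expr1n; congr (_ * expR _).
by rewrite mulNr.
Qed.

Lemma normal01_pdfN x : phi (- x) = phi x.
Proof. by rewrite !normal01_pdfE sqrrN. Qed.

(** Change of variables by the Radon-Nikodym derivative, which agrees with [phi] almost everywhere
    because both have the same integral over every measurable set. *)
Lemma ge0_integral_normal01 (f : R -> \bar R) : (forall x, 0 <= f x)%E ->
  measurable_fun setT f ->
  (\int[N01]_x f x = \int[mu]_x (f x * (phi x)%:E))%E.
Proof.
move=> f0 mf.
pose nu : {finite_measure set (measurableTypeR R) -> \bar R} := N01.
have dom : nu `<< mu by exact: normal_prob_dominates.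
have <- := Radon_Nikodym_SigmaFinite.change_of_variables dom f0 measurableT mf.
have mphi : measurable_fun setT (EFin \o phi).
  by apply/measurable_EFinP; exact: measurable_normal_pdf.
have irn := Radon_Nikodym_SigmaFinite.f_integrable dom.
apply: ae_eq_integral => //.
- by apply: emeasurable_funM => //; exact: measurable_int irn.
- exact: emeasurable_funM.
- apply: ae_eqe_mul2l; apply: integral_ae_eq => // E _ mE.
  by rewrite -Radon_Nikodym_SigmaFinite.f_integral.
Qed.

Lemma is_derive_normal01_pdf (x : R) :
  is_derive x 1 (fun z => - phi z) (x * phi x).
Proof.
rewrite (_ : (fun z => _) = (fun z => - (normal_peak 1 * expR (- (z ^+ 2 / 2))))).
  apply: is_derive_eq; rewrite normal01_pdfE /GRing.scale /=.
  by field.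
by apply/funext => z; rewrite normal01_pdfE.
Qed.

Lemma cvg_normal01_pdf : phi x @[x --> +oo] --> (0 : R).
Proof.
rewrite (_ : phi = fun x => normal_peak 1 * expR (- (x ^+ 2 / 2))); last first.
  by apply/funext => z; rewrite normal01_pdfE.
rewrite -[X in _ --> X](mulr0 (normal_peak (1 : R))); apply: cvgM; first exact: cvg_cst.
apply: (@cvg_comp _ _ _ (fun x : R => x ^+ 2 / 2) (fun x => expR (- x)) _ +oo); last first.
  exact: cvgr_expR.
apply/cvgryPge => A; near=> x.
have x1 : 1 <= x by near: x; apply: nbhs_pinfty_ge; exact: num_real.
have xA : 2 * A <= x by near: x; apply: nbhs_pinfty_ge; exact: num_real.
nra.
Unshelve. all: by end_near. Qed.

Lemma continuous_mul_normal01_pdf : continuous (fun x : R => x * phi x).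
Proof. by move=> x; apply: cvgM; [exact: cvg_id|exact: continuous_normal_pdf]. Qed.

Lemma normal01_tail_ge (s : R) : 0 <= s ->
  (\int[mu]_(z in `[s, +oo[) (`|z| * phi z)%:E = (phi s)%:E)%E.
Proof.
move=> s0.
transitivity (\int[mu]_(z in `[s, +oo[) (z * phi z)%:E)%E.
  apply: eq_integral => z /set_mem; rewrite /= in_itv /= andbT => sz.
  by rewrite ger0_norm// (le_trans s0).
rewrite (@ge0_continuous_FTC2y R (fun z => z * phi z) (fun z => - phi z) s 0).
- by rewrite EFinN oppeK add0e.
- by move=> x sx; rewrite mulr_ge0 ?normal_pdf_ge0// (le_trans s0).
- by apply: continuous_subspaceT; exact: continuous_mul_normal01_pdf.
- by rewrite -[X in _ --> X]oppr0; apply: cvgN; exact: cvg_normal01_pdf.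
- by move=> x _; exact: (@ex_derive _ _ _ _ _ _ _ (is_derive_normal01_pdf x)).
- by apply: cvg_at_right_filter; apply: cvgN; exact: continuous_normal_pdf.
- by move=> x _; rewrite derive1E (@derive_val _ _ _ _ _ _ _ (is_derive_normal01_pdf x)).
Qed.

Lemma normal01_tail_lt (s : R) : s <= 0 ->
  (\int[mu]_(z in `]-oo, s[) (`|z| * phi z)%:E = (phi s)%:E)%E.
Proof.
move=> s0; have c : continuous (fun z => `|z| * phi z).
  by move=> x; apply: cvgM; [exact: norm_continuous|exact: continuous_normal_pdf].
rewrite integral_itv_bndo_bndc; last first.
  apply/measurable_EFinP; apply: measurable_funTS; exact: continuous_measurable_fun.
rewrite -[in LHS](opprK s) (ge0_integration_by_substitutionNy (G := fun z => `|z| * phi z)).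
- under eq_integral do rewrite /= normrN normal01_pdfN.
  by rewrite normal01_tail_ge ?oppr_ge0// normal01_pdfN.
- exact: continuous_subspaceT.
- by move=> x _; rewrite mulr_ge0 ?normal_pdf_ge0.
Qed.

(** The domain of the double integral in [stein_nonexpansive]. The ends are half-open so that the
    section at fixed z is ]0, z] or ]z, 0], as in [integral_derive1_nonexpansive]; the section at
    fixed s is a half-line carrying a Gaussian tail. *)
Definition between0 (z s : R) := (0 < s <= z) || (z < s <= 0).

Lemma between0_row z :
  between0 z = mem (if 0 < z then `]0, z]%classic else `]z, 0]%classic).
Proof.
apply/funext => s; rewrite /between0.
case: ifPn => [z0|]; last rewrite -leNgt => z0.
  rewrite (_ : (z < s <= 0) = false); last first.
    by apply/negP => /andP[/(lt_trans z0) /lt_le_trans h /h]; rewrite ltxx.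
  by rewrite orbF; apply/idP/idP => [H|/set_mem]; [apply/mem_set|]; rewrite /= in_itv.
rewrite (_ : (0 < s <= z) = false); last first.
  by apply/negP => /andP[s0 sz]; have := lt_le_trans s0 (le_trans sz z0); rewrite ltxx.
by apply/idP/idP => [H|/set_mem]; [apply/mem_set|]; rewrite /= in_itv.
Qed.

Lemma between0_col s :
  between0 ^~ s = mem (if 0 < s then `[s, +oo[%classic else `]-oo, s[%classic).
Proof.
apply/funext => z; rewrite /between0.
case: ifPn => [s0|]; last rewrite -leNgt => s0.
  rewrite [s <= 0]leNgt s0 andbF orbF.
  by apply/idP/idP => [H|/set_mem]; [apply/mem_set|]; rewrite /= in_itv /= andbT.
rewrite s0 andbT /=.
by apply/idP/idP => [H|/set_mem]; [apply/mem_set|]; rewrite /= in_itv.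
Qed.

(* By Tonelli, [E[Z (f Z - f 0)]] is the integral of [|z| phi z f'(s)] over
   [between0 z s], and integrating first in [z] leaves the two Gaussian tails [phi s]. *)
Lemma stein_nonexpansive (f : R -> R) :
  {homo f : x y / x <= y} -> (forall x y, x <= y -> f y - f x <= y - x) ->
  (\int[N01]_z (z * (f z - f 0))%:E = \int[N01]_z (derive1 f z)%:E)%E.
Proof.
move=> ndf lipf; have cf := nonexpansive_continuous ndf lipf.
have mf : measurable_fun setT f by exact: continuous_measurable_fun.
have md : measurable_fun setT (derive1 f) by exact: measurable_derive1.
have d0 := derive1_nonexpansive_ge0 ndf.
have zf0 z : 0 <= z * (f z - f 0).
  case: (leP 0 z) => [z0|/ltW z0]; first by rewrite mulr_ge0// subr_ge0 ndf.
  by rewrite mulr_le0// subr_le0 ndf.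
have mphi : measurable_fun setT phi by exact: measurable_normal_pdf.
rewrite !ge0_integral_normal01; last 4 first.
- by move=> z; rewrite lee_fin.
- exact/measurable_EFinP.
- by move=> z; rewrite lee_fin.
- by apply/measurable_EFinP; apply: measurable_funM => //; exact: measurable_funB.
pose K (p : R * R) : \bar R :=
  if between0 p.1 p.2 then ((`|p.1| * phi p.1) * derive1 f p.2)%:E else 0%E.
have mb : measurable_fun setT (fun p : R * R => between0 p.1 p.2).
  apply: measurable_or; apply: measurable_and;
    by [apply: measurable_fun_ltr|apply: measurable_fun_ler].
have mK : measurable_fun setT K.
  apply: measurable_fun_ifT => //; apply/measurable_EFinP.
  apply: measurable_funM; last exact: measurableT_comp.
  apply: measurable_funM; last exact: measurableT_comp.
  exact: measurableT_comp.
have K0 p : (0 <= K p)%E.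
  by rewrite /K; case: ifP => // _; rewrite lee_fin !mulr_ge0 ?normal_pdf_ge0.
have row (z : R) : (\int[mu]_s K (z, s) = (z * (f z - f 0))%:E * (phi z)%:E)%E.
  pose D := if 0 < z then `]0, z]%classic else `]z, 0]%classic.
  transitivity (\int[mu]_(s in D) ((`|z| * phi z)%:E * (derive1 f s)%:E))%E.
    rewrite [RHS]integral_mkcond; congr integral; apply/funext => s.
    by rewrite patchE /K /= between0_row EFinM.
  have mD : measurable D by rewrite /D; case: ifP.
  rewrite ge0_integralZl//; last 3 first.
  - by apply/measurable_EFinP; exact: measurable_funTS.
  - by move=> x _; rewrite lee_fin.
  - by rewrite lee_fin mulr_ge0 ?normal_pdf_ge0.
  rewrite /D; case: ltP => z0.
    rewrite (integral_derive1_nonexpansive ndf lipf (ltW z0)) -!EFinM gtr0_norm//.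
    by congr EFin; ring.
  rewrite (integral_derive1_nonexpansive ndf lipf z0) -!EFinM ler0_norm//.
  by congr EFin; ring.
have col (s : R) : (\int[mu]_z K (z, s) = (derive1 f s)%:E * (phi s)%:E)%E.
  pose D := if 0 < s then `[s, +oo[%classic else `]-oo, s[%classic.
  transitivity (\int[mu]_(z in D) ((derive1 f s)%:E * (`|z| * phi z)%:E))%E.
    rewrite [RHS]integral_mkcond; congr integral; apply/funext => z.
    by rewrite patchE /K /= -[between0 z s]/((between0 ^~ s) z) between0_col EFinM muleC.
  have mD : measurable D by rewrite /D; case: ifP.
  rewrite ge0_integralZl//; last 3 first.
  - apply/measurable_EFinP; apply: measurable_funTS.
    by apply: measurable_funM => //; exact: measurableT_comp.
  - by move=> x _; rewrite lee_fin mulr_ge0 ?normal_pdf_ge0.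
  - by rewrite lee_fin.
  by rewrite /D; case: ltP => s0; [rewrite normal01_tail_ge// ltW|rewrite normal01_tail_lt].
under eq_integral do rewrite -row.
under [RHS]eq_integral do rewrite -col.
exact: (@fubini_tonelli _ _ (measurableTypeR R) (measurableTypeR R) R mu mu K mK K0).
Qed.

End Gaussian.

(** * Gaussian moments and affine rescaling of nonexpansive functions *)

Section GaussianMoments.
Context {R : realType}.
Notation mu := (@lebesgue_measure R).
Notation phi := (@normal_pdf R 0 1).
Notation N01 := (@normal_prob R 0 1).

(** Integration by parts applied to the identity function. *)
Lemma normal01_second_moment : (\int[N01]_z (z ^+ 2)%:E = 1)%E.
Proof.
have /= := @stein_nonexpansive R id (fun x y xy => xy) (fun x y xy => lexx _).
under eq_integral do rewrite subr0 -expr2.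
move=> ->; rewrite (eq_integral (fun=> 1%E)).
  by rewrite integral_cst// mul1e; exact: (probability_setT N01).
by move=> z _; rewrite derive1E derive_id.
Qed.

Lemma integrable_normal01_sqr : N01.-integrable setT (fun z : R => (z ^+ 2)%:E).
Proof.
apply/integrableP; split.
  by apply/measurable_EFinP; exact: measurable_funX.
under eq_integral do rewrite gee0_abs ?lee_fin ?sqr_ge0//.
by rewrite normal01_second_moment ltry.
Qed.

Lemma integrable_normal01_id : N01.-integrable setT (fun z : R => z%:E).
Proof.
apply: (@le_integrable _ _ _ N01 setT measurableT _ (fun z : R => (1 + z ^+ 2)%:E)) => //.
- exact/measurable_EFinP.
- move=> z _; rewrite lee_fin [leRHS]ger0_norm ?addr_ge0 ?sqr_ge0//.
  have : 0 <= (`|z| - 1) ^+ 2 by exact: sqr_ge0.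
  have : `|z| ^+ 2 = z ^+ 2 by rewrite real_normK ?num_real.
  have := sqr_ge0 z; nra.
- apply: (@integrableD _ _ _ N01 setT measurableT (cst 1%E) (fun z : R => (z ^+ 2)%:E)) => //;
    last exact: integrable_normal01_sqr.
  exact: finite_measure_integrable_cst.
Qed.

Lemma normal01_mean : (\int[N01]_z z%:E = 0)%E.
Proof.
rewrite integralE.
have mx : measurable_fun setT (fun z : R => z%:E) by exact/measurable_EFinP.
rewrite !ge0_integral_normal01//; last 2 first.
- exact: measurable_funeneg.
- exact: measurable_funepos.
have -> : (\int[mu]_x ((EFin)^\+ x * (phi x)%:E) = (phi 0)%:E)%E.
  rewrite -(@normal01_tail_ge R 0)// [RHS]integral_mkcond.
  apply: eq_integral => z _; rewrite patchE funeposE.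
  case: ifPn => [/set_mem|/negP].
    by rewrite /= in_itv /= andbT => z0; rewrite max_l ?lee_fin// ger0_norm.
  move=> zn; have z0 : z <= 0.
    by rewrite leNgt; apply/negP => z0; apply/zn/mem_set; rewrite /= in_itv /= andbT ltW.
  by rewrite max_r ?lee_fin// mul0e.
have -> : (\int[mu]_x ((EFin)^\- x * (phi x)%:E) = (phi 0)%:E)%E.
  rewrite -(@normal01_tail_lt R 0)// [RHS]integral_mkcond.
  apply: eq_integral => z _; rewrite patchE funenegE.
  case: ifPn => [/set_mem|/negP].
    rewrite /= in_itv /= => z0; rewrite max_l ?lee_fin ?oppr_ge0 ?ltW//.
    by rewrite ler0_norm ?ltW.
  move=> zn; have z0 : 0 <= z.
    by rewrite leNgt; apply/negP => z0; apply/zn/mem_set; rewrite /= in_itv.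
  by rewrite max_r ?lee_fin ?oppr_le0// mul0e.
by rewrite subee.
Qed.

(** The density [phi] is positive, so the derivative vanishes Lebesgue-almost everywhere, and the
    increments of [f] are integrals of its derivative. *)
Lemma normal01_derive1_eq0 (f : R -> R) :
  {homo f : x y / x <= y} -> (forall x y, x <= y -> f y - f x <= y - x) ->
  (\int[N01]_z (derive1 f z)%:E = 0)%E -> forall u v, f u = f v.
Proof.
move=> ndf lipf; have md : measurable_fun setT (derive1 f).
  by apply: measurable_derive1; exact: nonexpansive_continuous.
have d0 := derive1_nonexpansive_ge0 ndf.
have mphi : measurable_fun setT phi by exact: measurable_normal_pdf.
rewrite ge0_integral_normal01; last 2 first.
- by move=> z; rewrite lee_fin.
- exact/measurable_EFinP.
move=> I0.
have ae0 : ae_eq mu setT (fun z => ((derive1 f z)%:E * (phi z)%:E)%E) (cst 0%E).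
  apply/ae_eq_integral_abs => //.
    by apply: emeasurable_funM; exact/measurable_EFinP.
  under eq_integral do rewrite gee0_abs -?EFinM ?lee_fin ?mulr_ge0 ?normal_pdf_ge0// EFinM.
  exact: I0.
suff W u v : u <= v -> f v - f u = 0.
  move=> u v; case: (leP u v) => [/W/eqP|/ltW/W/eqP]; rewrite subr_eq0 => /eqP -> //.
move=> uv; apply: EFin_inj; rewrite -(integral_derive1_nonexpansive ndf lipf uv).
rewrite (ae_eq_integral (cst 0%E))//; first exact: integral0.
  by apply/measurable_EFinP; exact: measurable_funTS.
apply: filterS ae0.
move=> z /= /(_ I) H _; have : derive1 f z * phi z = 0 by exact: (EFin_inj H).
move=> /eqP; rewrite mulf_eq0 => /orP[/eqP -> //|].
by rewrite normal01_pdfE mulf_eq0 gt_eqF ?normal_peak_gt0 ?oner_neq0// gt_eqF ?expR_gt0.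
Qed.

(** An equality of filters rather than a convergence, so that [derive1_affine] also equates the
    default values where there is no derivative. *)
Lemma dnbhs0_scale (r : R) : r != 0 -> r * h @[h --> 0^'] = (0 : R)^'.
Proof.
have cv (s : R) : s != 0 -> s * h @[h --> 0^'] --> (0 : R)^'.
  move=> s0 A /= /nbhs_ballP[e /= e0 eA].
  apply/nbhs_ballP; exists (e / `|s|); first by rewrite /= divr_gt0// normr_gt0.
  move=> h /= + h0; rewrite /ball /= !sub0r !normrN ltr_pdivlMr ?normr_gt0// => hs.
  by apply: eA; rewrite ?mulf_neq0// /ball /= sub0r normrN normrM mulrC.
move=> r0; apply/seteqP; split; last exact: cv.
move=> A A0; have rV0 : r^-1 != 0 by rewrite invr_eq0.
have := cv _ rV0 _ A0; rewrite /= /nbhs /= => H.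
rewrite (_ : A = [set h | A (r * (r^-1 * h))])//.
by apply/funext => h /=; rewrite mulrA mulfV// mul1r.
Qed.

Lemma derive1_affine (f : R -> R) (b r z : R) : 0 < r ->
  derive1 (fun z => f (b + r * z) / r) z = derive1 f (b + r * z).
Proof.
move=> r0; have rn0 : r != 0 by rewrite gt_eqF.
rewrite /derive1 -[in RHS](dnbhs0_scale rn0).
pose q k := k^-1 *: (f (k + (b + r * z)) - f (b + r * z)).
suff -> : (fun h => h^-1 *: (f (b + r * (h + z)) / r - f (b + r * z) / r)) =
    q \o (fun h => r * h) by [].
apply/funext => h /=; rewrite /q.
have -> : b + r * (h + z) = r * h + (b + r * z) by ring.
by rewrite /GRing.scale /= invfM mulrBr; ring.
Qed.

Lemma nonexpansive_affine (f : R -> R) (b r : R) :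
  {homo f : x y / x <= y} -> (forall x y, x <= y -> f y - f x <= y - x) -> 0 < r ->
  {homo (fun z => f (b + r * z) / r) : x y / x <= y} /\
  (forall x y, x <= y -> f (b + r * y) / r - f (b + r * x) / r <= y - x).
Proof.
move=> ndf lipf r0.
have le_aff x y : x <= y -> b + r * x <= b + r * y by move=> xy; rewrite lerD2l ler_pM2l.
split=> x y xy; first by rewrite ler_pM2r ?invr_gt0// ndf// le_aff.
rewrite -mulrBl ler_pdivrMr//; apply: le_trans (lipf _ _ (le_aff _ _ xy)) _.
by rewrite le_eqVlt; apply/orP; left; apply/eqP; ring.
Qed.

End GaussianMoments.

Lemma integral_probability_cst d (T : measurableType d) (R : realType)
  (P : probability T R) (c : \bar R) : (\int[P]_x c = c)%E.
Proof.
rewrite (integral_cst P measurableT c) -[RHS]mule1; congr (_ * _)%E.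
exact: probability_setT.
Qed.

Section Quadratic.
Context d (T : measurableType d) (R : realType) (m : {measure set T -> \bar R}).
Variables B Z : T -> R.
Hypothesis m1 : m setT = 1%E.
Hypothesis B2 : m.-integrable setT (fun w => (B w ^+ 2)%:E).
Hypothesis Z2 : m.-integrable setT (fun w => (Z w ^+ 2)%:E).

Lemma integrable_cst1 : m.-integrable setT (fun=> 1%E).
Proof.
apply/integrableP; split; first exact: measurable_cst.
by under eq_integral do rewrite abse1; rewrite (integral_cst m measurableT 1%E) mul1e m1 ltry.
Qed.

Lemma integrable_quadratic (K : R) (g : T -> R) : measurable_fun setT g ->
  (forall w, `|g w| <= K * (1 + B w ^+ 2 + Z w ^+ 2)) ->
  m.-integrable setT (EFin \o g).
Proof.
move=> mg gK.
pose G := fun w => (K%:E * ((1%:E + (B w ^+ 2)%:E) + (Z w ^+ 2)%:E))%E.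
apply: (@le_integrable _ _ _ m setT measurableT _ G) => //.
- exact/measurable_EFinP.
- move=> w _; rewrite lee_fin.
  exact: le_trans (gK w) (ler_norm _).
- apply: integrableZl => //; apply: integrableD => //; apply: integrableD => //.
  exact: integrable_cst1.
Qed.

End Quadratic.

(** * Integration by parts under the product law of B and Z *)

Section ProductStein.
Context {R : realType}.
Variable pi : probability (measurableTypeR R) R.
Notation N01 := (@normal_prob R 0 1).
Notation Q := (pi \x N01)%E.

Lemma normal01_setT : N01 setT = 1%E.
Proof. exact: (probability_setT N01). Qed.

Lemma product_normal_setT : Q setT = 1%E.
Proof.
rewrite -setXTT product_measure1E//.
transitivity (1 * 1 : \bar R)%E; last by rewrite mule1.
by congr (_ * _)%E; [exact: probability_setT|exact: normal01_setT].
Qed.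

Lemma product_ge0_fst (g : R -> \bar R) : measurable_fun setT g ->
  (forall x, 0 <= g x)%E -> (\int[Q]_z g z.1 = \int[pi]_b g b)%E.
Proof.
move=> mg g0.
rewrite (@fubini_tonelli1 _ _ _ _ _ pi N01 (fun z => g z.1))//; last exact: measurableT_comp.
apply: eq_integral => b _; rewrite /fubini_F /=.
exact: (integral_probability_cst N01 (g b)).
Qed.

Lemma product_ge0_snd (g : R -> \bar R) : measurable_fun setT g ->
  (forall x, 0 <= g x)%E -> (\int[Q]_z g z.2 = \int[N01]_b g b)%E.
Proof.
move=> mg g0.
rewrite (@fubini_tonelli1 _ _ _ _ _ pi N01 (fun z => g z.2))//; last exact: measurableT_comp.
exact: (integral_probability_cst pi (\int[N01]_b g b)%E).
Qed.

Lemma product_integrable_fst_sqr : (\int[pi]_x ((x : R) ^+ 2)%:E < +oo)%E ->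
  Q.-integrable setT (fun z => ((z.1 : R) ^+ 2)%:E).
Proof.
move=> pi2; have m2 : measurable_fun setT (fun x : R => (x ^+ 2)%:E).
  by apply/measurable_EFinP; exact: measurable_funX.
apply/integrableP; split; first exact: (measurableT_comp m2).
under eq_integral do rewrite gee0_abs ?lee_fin ?sqr_ge0//.
rewrite (product_ge0_fst m2)// => x; by rewrite lee_fin sqr_ge0.
Qed.

Lemma product_second_moment_snd : (\int[Q]_z ((z.2 : R) ^+ 2)%:E = 1)%E.
Proof.
have m2 : measurable_fun setT (fun x : R => (x ^+ 2)%:E).
  by apply/measurable_EFinP; exact: measurable_funX.
rewrite (product_ge0_snd m2) ?normal01_second_moment// => x; by rewrite lee_fin sqr_ge0.
Qed.

Lemma product_integrable_snd_sqr : Q.-integrable setT (fun z => ((z.2 : R) ^+ 2)%:E).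
Proof.
have m2 : measurable_fun setT (fun x : R => (x ^+ 2)%:E).
  by apply/measurable_EFinP; exact: measurable_funX.
apply/integrableP; split; first exact: (measurableT_comp m2).
under eq_integral do rewrite gee0_abs ?lee_fin ?sqr_ge0//.
by rewrite product_second_moment_snd ltry.
Qed.

Variable f : R -> R.
Hypothesis ndf : {homo f : x y / x <= y}.
Hypothesis lipf : forall x y, x <= y -> f y - f x <= y - x.

(** Subtracting f(B) makes the integrand nonnegative, so Tonelli reduces the claim to
    [stein_nonexpansive] for z |-> f(b + r z) / r at each fixed b, with values in the extended
    reals. *)
Lemma product_stein_ge0 (r : R) : 0 < r ->
  (\int[Q]_z (z.2 * (f (z.1 + r * z.2) - f z.1))%:E =
   r%:E * \int[Q]_z (derive1 f (z.1 + r * z.2))%:E)%E.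
Proof.
move=> r0; have cf := nonexpansive_continuous ndf lipf.
have mf : measurable_fun setT f by exact: continuous_measurable_fun.
have md : measurable_fun setT (derive1 f) by exact: measurable_derive1.
have ma : measurable_fun setT
    (fun z : measurableTypeR R * measurableTypeR R => (z.1 : R) + r * z.2).
  by apply: measurable_funD => //; exact: measurable_funM.
have d0 := derive1_nonexpansive_ge0 ndf.
have mzf : measurable_fun setT (fun z : measurableTypeR R * measurableTypeR R =>
    (z.2 * (f (z.1 + r * z.2) - f z.1))%:E).
  apply/measurable_EFinP; apply: measurable_funM => //; apply: measurable_funB.
    exact: (measurableT_comp mf).
  exact: (measurableT_comp mf).
have mda : measurable_fun setT (fun z : measurableTypeR R * measurableTypeR R =>
    (derive1 f (z.1 + r * z.2))%:E).
  by apply/measurable_EFinP; exact: (measurableT_comp md).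
rewrite (fubini_tonelli1 _ mzf); last first.
  move=> z; rewrite lee_fin; case: (leP 0 (z.2 : R)) => [z0|/ltW z0].
    by apply: mulr_ge0 => //; rewrite subr_ge0; apply: ndf; rewrite lerDl pmulr_rge0.
  by apply: mulr_le0 => //; rewrite subr_le0; apply: ndf; rewrite gerDl pmulr_rle0.
rewrite (fubini_tonelli1 _ mda); last by move=> z; rewrite lee_fin.
rewrite -ge0_integralZl//; last 3 first.
- by apply: (measurable_fun_fubini_tonelli_F (m2 := N01) _ mda) => z; rewrite lee_fin.
- by move=> b _; apply: integral_ge0 => z _; rewrite lee_fin.
- by rewrite lee_fin ltW.
apply: eq_integral => b _; rewrite /fubini_F /=.
have [ndk lipk] := nonexpansive_affine b ndf lipf r0.
have := stein_nonexpansive ndk lipk.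
have mk : measurable_fun setT (fun z : R => f (b + r * z) / r).
  by apply: continuous_measurable_fun; exact: nonexpansive_continuous ndk lipk.
under [X in _ = X -> _]eq_integral do rewrite derive1_affine//.
move=> <-; rewrite -ge0_integralZl//; last 3 first.
- apply/measurable_EFinP; apply: measurable_funM => //.
  exact: measurable_funB.
- move=> z _; rewrite lee_fin; case: (leP 0 z) => [z0|/ltW z0].
    by apply: mulr_ge0 => //; rewrite subr_ge0; apply: ndk.
  by apply: mulr_le0 => //; rewrite subr_le0; apply: ndk.
- by rewrite lee_fin ltW.
apply: eq_integral => z _; rewrite -EFinM; congr EFin.
by rewrite mulr0 addr0; field; rewrite gt_eqF.
Qed.

End ProductStein.

Section ProductSteinReal.
Context {R : realType}.
Variable pi : probability (measurableTypeR R) R.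
Hypothesis pi2 : (\int[pi]_x ((x : R) ^+ 2)%:E < +oo)%E.
Notation N01 := (@normal_prob R 0 1).
Notation Q := (pi \x N01)%E.
Notation RR := (measurableTypeR R * measurableTypeR R)%type.

Variable f : R -> R.
Hypothesis ndf : {homo f : x y / x <= y}.
Hypothesis lipf : forall x y, x <= y -> f y - f x <= y - x.

Lemma nonexpansive_norm_le x : `|f x| <= `|f 0| + `|x|.
Proof.
have -> : f x = f 0 + (f x - f 0) by ring.
apply: le_trans (ler_normD _ _) _; rewrite lerD2l.
case: (leP 0 x) => [x0|/ltW x0].
  by rewrite !ger0_norm ?subr_ge0 ?ndf//; have := lipf x0; rewrite subr0.
by rewrite !ler0_norm ?subr_le0 ?ndf//; have := lipf x0; lra.
Qed.

Lemma integrable_product_mul (r : R) :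
  Q.-integrable setT (EFin \o (fun z : RR => z.2 * f (z.1 + r * z.2))).
Proof.
have cf := nonexpansive_continuous ndf lipf.
have mf : measurable_fun setT f by exact: continuous_measurable_fun.
apply: (@integrable_quadratic _ _ _ Q (fun z => z.1) (fun z => z.2) _ _ _
  (`|f 0| ^+ 2 + 2 + r ^+ 2)) => //.
- exact: product_normal_setT.
- exact: product_integrable_fst_sqr.
- exact: product_integrable_snd_sqr.
- apply: measurable_funM => //; apply: (measurableT_comp mf).
  by apply: measurable_funD => //; exact: measurable_funM.
- move=> [b z] /=; rewrite normrM.
  have h1 : `|f (b + r * z)| <= `|f 0| + `|b| + `|r| * `|z|.
    apply: le_trans (nonexpansive_norm_le _) _; rewrite -addrA lerD2l -normrM.
    exact: ler_normD.
  apply: le_trans (ler_wpM2l (normr_ge0 z) h1) _.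
  rewrite -[in leRHS](real_normK (num_real b)) -[in leRHS](real_normK (num_real z)).
  rewrite -[in leRHS](real_normK (num_real r)).
  move: (normr_ge0 b) (normr_ge0 z) (normr_ge0 r) (normr_ge0 (f 0)).
  clear h1; move: `|b| `|z| `|r| `|f 0| => {b z} b z s F b0 z0 s0 F0.
  have e1 := sqr_ge0 (z - b); have e2 := sqr_ge0 (F * z - 1).
  have e3 := sqr_ge0 (s * z - z).
  have e4 : 0 <= (F * b) ^+ 2 by exact: sqr_ge0.
  have e5 : 0 <= (s * b) ^+ 2 by exact: sqr_ge0.
  have e6 : 0 <= (F * z) ^+ 2 by exact: sqr_ge0.
  have e7 := sqr_ge0 (s * z); have e8 := sqr_ge0 b; have e9 := sqr_ge0 z.
  have e10 := sqr_ge0 F; have e11 := sqr_ge0 s.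
  nra.
Qed.

Lemma product_mul_snd_eq0 : \int[Q]_z (z.2 * f z.1) = 0.
Proof.
have iz := integrable_product_mul 0.
have iz0 : Q.-integrable setT (EFin \o (fun z : RR => z.2 * f z.1)).
  apply: eq_integrable iz => // z _; by rewrite /= mul0r addr0.
rewrite /Rintegral -(integral12_prod_meas1 iz0) (_ : integral _ _ _ = 0%E)//.
apply: integral0_eq => b _; rewrite /fubini_F /=.
under eq_integral do rewrite EFinM.
by rewrite (integralZr measurableT integrable_normal01_id) normal01_mean mul0e.
Qed.

Lemma product_stein (r : R) : 0 <= r ->
  \int[Q]_z (z.2 * f (z.1 + r * z.2)) = r * \int[Q]_z derive1 f (z.1 + r * z.2).
Proof.
rewrite le_eqVlt => /predU1P[<-|r0].
  rewrite mul0r -[RHS]product_mul_snd_eq0.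
  by apply: eq_Rintegral => z _; rewrite mul0r addr0.
have i1 := integrable_product_mul r; have i0 := integrable_product_mul 0.
have i0' : Q.-integrable setT (EFin \o (fun z : RR => z.2 * f z.1)).
  by apply: eq_integrable i0 => // z _; rewrite /= mul0r addr0.
have -> : \int[Q]_z (z.2 * f (z.1 + r * z.2)) =
    \int[Q]_z (z.2 * (f (z.1 + r * z.2) - f z.1)).
  under [RHS]eq_Rintegral do rewrite mulrBr.
  by rewrite RintegralB// product_mul_snd_eq0 subr0.
rewrite /Rintegral (product_stein_ge0 pi ndf lipf r0).
(* Were the integral of the derivative infinite, [fine] would send both sides to 0. *)
case: (integral _ _ _) => [x| |] //=.
  by rewrite gt0_muley ?lte_fin//= mulr0.
by rewrite gt0_muleNy ?lte_fin//= mulr0.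
Qed.

(** The correlation is r times the mean of a nonnegative derivative. If that mean vanished, the
    Gaussian integral of the derivative would vanish at some fixed b, and [normal01_derive1_eq0]
    would make [f] constant. *)
Lemma product_stein_gt0 (r : R) : 0 < r -> (exists u v, f u != f v) ->
  0 < \int[Q]_z (z.2 * f (z.1 + r * z.2)).
Proof.
move=> r0 [u [v fuv]].
have d0 := derive1_nonexpansive_ge0 ndf.
have cf := nonexpansive_continuous ndf lipf.
have md : measurable_fun setT (derive1 f) by exact: measurable_derive1.
have mda : measurable_fun setT (fun z : RR => (derive1 f (z.1 + r * z.2))%:E).
  apply/measurable_EFinP; apply: (measurableT_comp md).
  by apply: measurable_funD => //; exact: measurable_funM.
rewrite product_stein ?ltW// pmulr_rgt0// lt_neqAle Rintegral_ge0// andbT.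
apply/negP => /eqP/esym I0.
(* A zero real-valued integral could come from an infinite one through [fine]; integrability of Z
   (f(B + rZ) - f(B)) excludes this. *)
have I0' : (\int[Q]_z (derive1 f (z.1 + r * z.2))%:E = 0)%E.
  have i1 := integrable_product_mul r; have i0 := integrable_product_mul 0.
  have : Q.-integrable setT (EFin \o (fun z : RR => z.2 * (f (z.1 + r * z.2) - f z.1))).
    apply: (eq_integrable measurableT _ _ _ (integrableB measurableT i1 i0)) => z _ /=.
    by rewrite -EFinB mul0r addr0 mulrBr.
  move=> /(integrable_fin_num measurableT); rewrite /= (product_stein_ge0 pi ndf lipf r0).
  move: I0; rewrite /Rintegral; case: (integral _ _ _) => [x| |] //=.
  - by move=> ->.
  - by rewrite gt0_muley ?lte_fin.
  - by rewrite gt0_muleNy ?lte_fin.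
move: I0'; rewrite (fubini_tonelli1 _ mda); last by move=> z; rewrite lee_fin.
move=> I1.
have ae0 : ae_eq pi setT (fubini_F N01 (fun z : RR => (derive1 f (z.1 + r * z.2))%:E)) (cst 0%E).
  apply/ae_eq_integral_abs => //.
    by apply: (measurable_fun_fubini_tonelli_F (m2 := N01) _ mda) => z; rewrite lee_fin.
  rewrite -[RHS]I1; apply: eq_integral => b _; rewrite gee0_abs//.
  by apply: integral_ge0 => z _; rewrite lee_fin.
(* As [pi] has positive mass, a property true almost everywhere has a witness. *)
have [b /(_ I)] : exists b, setT b ->
    fubini_F N01 (fun z : RR => (derive1 f (z.1 + r * z.2))%:E) b = cst 0%E b.
  have Fpi : ProperFilter (almost_everywhere pi).
    apply: ae_properfilter_algebraOfSetsType.
    apply: lt_le_trans (@lte01 R) _; rewrite le_eqVlt; apply/orP; left.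
    by apply/eqP/esym; exact: probability_setT.
  exact: filter_ex ae0.
rewrite /fubini_F /= => Ib.
have [ndk lipk] := nonexpansive_affine b ndf lipf r0.
have := normal01_derive1_eq0 ndk lipk.
under eq_integral do rewrite derive1_affine//.
move=> /(_ Ib) H; move/eqP: fuv; apply.
have := H ((u - b) / r) ((v - b) / r).
rewrite !(mulrC r) !divfK ?gt_eqF// !subrKC => /(congr1 (fun x => x * r)).
by rewrite !divfK ?gt_eqF.
Qed.

End ProductSteinReal.

(** * Moments of the denoised signal *)

Lemma lipschitz_at_continuous (R : realType) (f : R * R -> R) (p : R * R) (e C : R) :
  0 < e ->
  (forall q, `|q.1 - p.1| < e -> `|q.2 - p.2| < e ->
     `|f q - f p| <= (`|q.1 - p.1| + `|q.2 - p.2|) * C) ->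
  {for p, continuous f}.
Proof.
move=> e0 H; apply/cvgrPdist_lt => eps eps0.
pose D := `|C| + 1; have D0 : 0 < D by rewrite ltr_wpDl.
pose del := Num.min e (eps / (2 * D)).
have del0 : 0 < del by rewrite lt_min e0 divr_gt0// mulr_gt0.
have := nbhsx_ballx p del del0; apply: filterS => q [/= q1 q2].
move: q1 q2; rewrite /ball /= !(distrC p.1, distrC p.2) => q1 q2.
have q1e : `|q.1 - p.1| < e by rewrite (lt_le_trans q1)// ge_min lexx.
have q2e : `|q.2 - p.2| < e by rewrite (lt_le_trans q2)// ge_min lexx.
rewrite distrC; apply: le_lt_trans (H q q1e q2e) _.
have dD : del * (2 * D) <= eps by rewrite -ler_pdivlMr ?mulr_gt0// ge_min lexx orbT.
apply: (@le_lt_trans _ _ ((`|q.1 - p.1| + `|q.2 - p.2|) * `|C|)).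
  by rewrite ler_wpM2l ?addr_ge0// ler_norm.
apply: (@le_lt_trans _ _ (2 * del * `|C|)).
  by rewrite ler_wpM2r//; move: q1 q2; lra.
apply: lt_le_trans dD; rewrite /D.
nra.
Qed.

Section Channel.
Context d (T : measurableType d) (R : realType) (m : {measure set T -> \bar R}).
Variables B Z : T -> R.
Hypothesis mB : measurable_fun setT B.
Hypothesis mZ : measurable_fun setT Z.
Hypothesis m1 : m setT = 1%E.
Hypothesis B2 : m.-integrable setT (fun w => (B w ^+ 2)%:E).
Hypothesis Z2 : m.-integrable setT (fun w => (Z w ^+ 2)%:E).

Let W w := 1 + `|B w| + `|Z w|.

Let W1 w : 1 <= W w.
Proof. by rewrite /W -addrA lerDl addr_ge0. Qed.

(** A class stable under linear combinations in which products of two members are integrable,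
    because B and Z are square-integrable. *)
Definition linear_growth (g : T -> R) := measurable_fun setT g /\
  exists K, forall w, `|g w| <= K * (1 + `|B w| + `|Z w|).

Lemma linear_growth_ge0 g : linear_growth g ->
  measurable_fun setT g /\ exists2 K, 0 <= K & forall w, `|g w| <= K * W w.
Proof.
move=> [mg [K gK]]; split => //; exists `|K| => // w.
by apply: le_trans (gK w) _; rewrite ler_wpM2r ?ler_norm// (le_trans ler01).
Qed.

Lemma linear_growthB : linear_growth B.
Proof. by split=> //; exists 1 => w; have := normr_ge0 (Z w); lra. Qed.

Lemma linear_growthZ : linear_growth Z.
Proof. by split=> //; exists 1 => w; have := normr_ge0 (B w); lra. Qed.

Lemma linear_growth_cst c : linear_growth (fun=> c).
Proof.
split; first exact: measurable_cst.
by exists `|c| => w; rewrite ler_peMr// W1.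
Qed.

Lemma linear_growthD f g : linear_growth f -> linear_growth g ->
  linear_growth (fun w => f w + g w).
Proof.
move=> [mf [K fK]] [mg [L gL]]; split; first exact: measurable_funD.
by exists (K + L) => w; rewrite mulrDl (le_trans (ler_normD _ _))// lerD.
Qed.

Lemma linear_growthM c g : linear_growth g -> linear_growth (fun w => c * g w).
Proof.
move=> [mg [K gK]]; split; first exact: measurable_funM.
by exists (`|c| * K) => w; rewrite normrM -mulrA ler_wpM2l.
Qed.

Lemma linear_growth_sub f g : linear_growth f -> linear_growth g ->
  linear_growth (fun w => f w - g w).
Proof.
move=> lf /(linear_growthM (-1)) lg; have := linear_growthD lf lg.
by under eq_fun do rewrite mulN1r.
Qed.

Lemma integrable_linear_growthM f g : linear_growth f -> linear_growth g ->
  m.-integrable setT (EFin \o (fun w => f w * g w)).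
Proof.
move=> /linear_growth_ge0[mf [K K0 fK]] /linear_growth_ge0[mg [L L0 gL]].
apply: (integrable_quadratic (K := 3 * (K * L)) m1 B2 Z2).
  exact: measurable_funM.
move=> w; rewrite normrM.
apply: (@le_trans _ _ ((K * W w) * (L * W w))); first exact: ler_pM.
have KL : 0 <= K * L by rewrite mulr_ge0.
rewrite (_ : K * W w * (L * W w) = K * L * (W w ^+ 2)); last by ring.
rewrite (mulrC 3) -(mulrA _ 3) ler_wpM2l// /W.
rewrite -[in leRHS](real_normK (num_real (B w))) -[in leRHS](real_normK (num_real (Z w))).
have := sqr_ge0 (1 - `|B w|); have := sqr_ge0 (1 - `|Z w|).
have := sqr_ge0 (`|B w| - `|Z w|); nra.
Qed.

Lemma integrable_linear_growth_sqr f : linear_growth f ->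
  m.-integrable setT (EFin \o (fun w => f w ^+ 2)).
Proof.
by move=> lf; have := integrable_linear_growthM lf lf; under eq_fun do rewrite -expr2.
Qed.

Lemma Rintegral_dist_le (f g : T -> R) (C : R) :
  m.-integrable setT (EFin \o f) -> m.-integrable setT (EFin \o g) ->
  (forall w, `|f w - g w| <= C * W w ^+ 2) ->
  `|\int[m]_w f w - \int[m]_w g w| <= C * \int[m]_w (W w ^+ 2).
Proof.
move=> fi gi fg.
have lW : linear_growth W.
  split; last by exists 1 => w; rewrite mul1r ger0_norm// (le_trans ler01).
  apply: measurable_funD; last exact: measurableT_comp.
  by apply: measurable_funD => //; exact: measurableT_comp.
have iW := integrable_linear_growth_sqr lW.
have fgi : m.-integrable setT (EFin \o (fun w => f w - g w)).
  by apply: (eq_integrable measurableT _ _ _ (integrableB measurableT fi gi)) => w _.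
rewrite -RintegralB// -RintegralZl//.
apply: le_trans (le_normr_Rintegral measurableT fgi) _.
apply: le_Rintegral => //; first exact: integrable_norm.
by apply: (eq_integrable measurableT _ _ _ (integrableZl measurableT C iW)) => w _.
Qed.

End Channel.

(** * The proximal map applied to B + rZ: continuity and growth of its moments *)

Section ProxChannel.
Context d (T : measurableType d) (R : realType) (m : {measure set T -> \bar R}).
Variables B Z : T -> R.
Hypothesis mB : measurable_fun setT B.
Hypothesis mZ : measurable_fun setT Z.
Hypothesis m1 : m setT = 1%E.
Hypothesis B2 : m.-integrable setT (fun w => (B w ^+ 2)%:E).
Hypothesis Z2 : m.-integrable setT (fun w => (Z w ^+ 2)%:E).
Hypothesis EZ2 : \int[m]_w (Z w ^+ 2) = 1.
(** Independence of B from the centred Z enters as this orthogonality; it is applied to the proximal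
    maps and to the identity. *)
Hypothesis EZf : forall f : R -> R, {homo f : x y / x <= y} ->
  (forall x y, x <= y -> f y - f x <= y - x) -> \int[m]_w (Z w * f (B w)) = 0.
Variable h : R -> \bar R.
Hypothesis hcc : closed_convex h.

Let W w := 1 + `|B w| + `|Z w|.
Let lB : linear_growth B Z B := linear_growthB Z mB.
Let lZ : linear_growth B Z Z := linear_growthZ B mZ.
Let integrableM := integrable_linear_growthM m1 B2 Z2.
Let integrable_sqr := integrable_linear_growth_sqr m1 B2 Z2.

Definition prox_channel (a r : R) (w : T) := prox a h (B w + r * Z w).
Definition prox_corr (a r : R) := \int[m]_w (Z w * prox_channel a r w).
Definition prox_mse (a r : R) := \int[m]_w ((prox_channel a r w - B w) ^+ 2).

(** Going from step b down to a, [prox_scale_lipschitz] has factor |a - b| / b <= 1, so the size of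
    [prox a h 0] is at most twice that of [prox b h 0], uniformly in a <= b. *)
Lemma prox_bound (a b y : R) : 0 < a <= b -> `|prox a h y| <= 2 * `|prox b h 0| + `|y|.
Proof.
move=> /andP[a0 ab]; have b0 : 0 < b by exact: lt_le_trans ab.
have h1 := prox_nonexpansive 0 y hcc a0; rewrite subr0 in h1.
have h2 := prox_scale_lipschitz 0 hcc b0 a0.
have h3 : `|a - b| / b <= 1.
  by rewrite ler_pdivrMr// mul1r ler0_norm ?subr_le0//; lra.
have {}h2 : `|prox a h 0 - prox b h 0| <= `|prox b h 0|.
  by apply: le_trans h2 _; rewrite sub0r normrN ler_piMr.
have -> : prox a h y = (prox a h y - prox a h 0) + (prox a h 0 - prox b h 0) + prox b h 0.
  by ring.
apply: le_trans (ler_normD _ _) _.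
have := ler_normD (prox a h y - prox a h 0) (prox a h 0 - prox b h 0); lra.
Qed.

Lemma prox_channel_bound (a b r w : R) x : 0 < a <= b -> `|r| <= w ->
  `|prox_channel a r x| <= (2 * `|prox b h 0| + 1 + w) * W x.
Proof.
move=> ab rw; apply: le_trans (prox_bound _ ab) _.
apply: (@le_trans _ _ (2 * `|prox b h 0| + (`|B x| + `|r| * `|Z x|))).
  by rewrite lerD2l -normrM ler_normD.
rewrite /W; have P0 := normr_ge0 (prox b h 0); have B0 := normr_ge0 (B x).
have Z0 := normr_ge0 (Z x); have w0 : 0 <= w := le_trans (normr_ge0 r) rw.
have : `|r| * `|Z x| <= w * `|Z x| by rewrite ler_wpM2r.
have : 0 <= w * `|B x| by rewrite mulr_ge0.
have : 0 <= `|prox b h 0| * `|B x| by rewrite mulr_ge0.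
have : 0 <= `|prox b h 0| * `|Z x| by rewrite mulr_ge0.
lra.
Qed.

Lemma linear_growth_prox_channel a r : 0 < a -> linear_growth B Z (prox_channel a r).
Proof.
move=> a0; split.
  have cp : continuous (prox a h).
    apply: nonexpansive_continuous => x y xy; first exact: prox_homo.
    exact: prox_ler_sub.
  apply: (measurableT_comp (continuous_measurable_fun cp)).
  by apply: measurable_funD => //; exact: measurable_funM.
exists (2 * `|prox a h 0| + 1 + `|r|) => w.
by apply: prox_channel_bound; rewrite ?a0 ?lexx.
Qed.

Let lx a r (a0 : 0 < a) := linear_growth_prox_channel r a0.

(** The noise level moves from r to s at the new step b, where [prox] is nonexpansive; then the step
    moves from a to b at the old argument. Thus only (a, r) has to be bounded by w, and b need only
    be positive. *)
Lemma prox_channel_dist (a b r s w : R) x : 0 < a <= w -> 0 < b -> `|r| <= w -> 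
  `|prox_channel b s x - prox_channel a r x| <=
  (`|b - a| + `|s - r|) * ((1 + (2 * `|prox w h 0| + 2 + 2 * w) / a) * W x).
Proof.
move=> aw b0 rw; have a0 : 0 < a by case/andP: aw.
set y := B x + r * Z x; set y' := B x + s * Z x.
have e1 : `|prox b h y' - prox b h y| <= `|s - r| * `|Z x|.
  apply: le_trans (prox_nonexpansive _ _ hcc b0) _.
  by rewrite -normrM /y /y' (_ : _ - _ = (s - r) * Z x)//; ring.
have e2 := prox_scale_lipschitz y hcc a0 b0.
have w0 : 0 <= w := le_trans (normr_ge0 r) rw.
set P := `|prox w h 0|; have P0 : 0 <= P by exact: normr_ge0.
have B0 := normr_ge0 (B x); have Z0 := normr_ge0 (Z x).
have yW : `|y| <= (1 + w) * W x.
  apply: le_trans (ler_normD _ _) _; rewrite normrM /W.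
  have : `|r| * `|Z x| <= w * `|Z x| by rewrite ler_wpM2r.
  have : 0 <= w * `|B x| by rewrite mulr_ge0.
  lra.
have e3 : `|y - prox a h y| <= (2 * P + 2 + 2 * w) * W x.
  apply: le_trans (ler_normB _ _) _; have := prox_channel_bound x aw rw.
  by rewrite /prox_channel -/y -/P; lra.
have Wx0 : 0 <= W x by rewrite /W; lra.
rewrite /prox_channel -/y -/y'.
have -> : prox b h y' - prox a h y = (prox b h y' - prox b h y) + (prox b h y - prox a h y).
  by ring.
apply: le_trans (ler_normD _ _) _.
have d1 := normr_ge0 (b - a); have d2 := normr_ge0 (s - r).
have ZW : `|Z x| <= W x by rewrite /W; lra.
have e4 : `|prox b h y - prox a h y| <= `|b - a| * ((2 * P + 2 + 2 * w) / a * W x).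
  apply: le_trans e2 _; rewrite [leRHS](_ : _ = (2 * P + 2 + 2 * w) * W x * (`|b - a| / a)).
    by rewrite ler_wpM2r// divr_ge0// ltW.
  by field; rewrite gt_eqF.
have e5 : `|s - r| * `|Z x| <= `|s - r| * W x by rewrite ler_wpM2l.
have q0 : 0 <= (2 * P + 2 + 2 * w) / a by rewrite divr_ge0 ?addr_ge0 ?mulr_ge0// ltW.
have e6 : 0 <= `|s - r| * ((2 * P + 2 + 2 * w) / a * W x).
  by apply: mulr_ge0 => //; exact: mulr_ge0.
have e7 : 0 <= `|b - a| * W x by rewrite mulr_ge0.
apply: (@le_trans _ _ (`|s - r| * W x + `|b - a| * ((2 * P + 2 + 2 * w) / a * W x))).
  by apply: lerD => //; exact: le_trans e5.
rewrite [(1 + _) * W x]mulrDl mul1r; move: e6 e7; move: ((2 * P + 2 + 2 * w) / a * W x) => q; lra.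
Qed.

Lemma integrable_prox_corr a r : 0 < a ->
  m.-integrable setT (EFin \o (fun w => Z w * prox_channel a r w)).
Proof. by move=> a0; apply: integrableM => //; exact: lx. Qed.

Lemma integrable_prox_mse a r : 0 < a ->
  m.-integrable setT (EFin \o (fun w => (prox_channel a r w - B w) ^+ 2)).
Proof.
by move=> a0; apply: integrable_sqr; apply: linear_growth_sub => //; exact: lx.
Qed.

Lemma continuous_prox_corr a r : 0 < a ->
  {for (a, r), continuous (fun p => prox_corr p.1 p.2)}.
Proof.
move=> a0; pose w := Num.max a `|r|.
have aw : 0 < a <= w by rewrite a0 le_max lexx.
have rw : `|r| <= w by rewrite le_max lexx orbT.
pose C := 1 + (2 * `|prox w h 0| + 2 + 2 * w) / a.
apply: (@lipschitz_at_continuous _ _ _ a (C * \int[m]_x (W x ^+ 2))) => // -[b s] /= ba _.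
have b0 : 0 < b by move: ba; rewrite ltr_norml => /andP[? _]; lra.
rewrite mulrA; apply: (Rintegral_dist_le mB mZ m1 B2 Z2).
- exact: integrable_prox_corr.
- exact: integrable_prox_corr.
move=> x; rewrite -mulrBr normrM.
have := prox_channel_dist s x aw b0 rw; rewrite -/C => H.
apply: (@le_trans _ _ (W x * ((`|b - a| + `|s - r|) * (C * W x)))); last first.
  by rewrite le_eqVlt; apply/orP; left; apply/eqP; rewrite /W; ring.
by apply: ler_pM => //; rewrite /W; have := normr_ge0 (B x); lra.
Qed.

Lemma continuous_prox_mse a r : 0 < a ->
  {for (a, r), continuous (fun p => prox_mse p.1 p.2)}.
Proof.
(* Within distance min a 1 of (a, r) the step stays below 2 a and the noise level below |r| + 1, so
   one [w] bounds both factors in the difference of squares. *)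
move=> a0; pose w := Num.max (2 * a) (`|r| + 1).
have aw : 0 < a <= w by rewrite a0 le_max; apply/orP; left; lra.
have rw : `|r| <= w by rewrite le_max; apply/orP; right; lra.
pose C := 1 + (2 * `|prox w h 0| + 2 + 2 * w) / a.
pose D := 2 * (2 * `|prox w h 0| + 1 + w) + 2.
have e0 : 0 < Num.min a 1 by rewrite lt_min a0 ltr01.
apply: (@lipschitz_at_continuous _ _ _ (Num.min a 1) (C * D * \int[m]_x (W x ^+ 2))) => //.
move=> -[b s] /=; rewrite !lt_min => /andP[ba _] /andP[_ sr].
have b0 : 0 < b by move: ba; rewrite ltr_norml => /andP[? _]; lra.
have bw : 0 < b <= w.
  by rewrite b0 le_max; apply/orP; left; move: ba; rewrite ltr_norml => /andP[_ ?]; lra.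
have sw : `|s| <= w.
  rewrite le_max; apply/orP; right.
  by have := ler_normD (s - r) r; rewrite subrK; lra.
rewrite !mulrA; apply: (Rintegral_dist_le mB mZ m1 B2 Z2).
- exact: integrable_prox_mse.
- exact: integrable_prox_mse.
move=> x.
have := prox_channel_dist s x aw b0 rw; rewrite -/C => H.
have H1 := prox_channel_bound x aw rw; have H2 := prox_channel_bound x bw sw.
move: H H1 H2; set p := prox_channel a r x; set q := prox_channel b s x => H H1 H2.
rewrite (_ : (q - B x) ^+ 2 - (p - B x) ^+ 2 = (q - p) * (q + p - 2 * B x)); last by ring.
rewrite normrM.
have H3 : `|q + p - 2 * B x| <= D * W x.
  apply: le_trans (ler_normB _ _) _; rewrite normrM (ger0_norm (ler0n _ 2)).
  have := ler_normD q p; have := normr_ge0 (Z x); move: H1 H2; rewrite /D.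
  have : `|B x| <= W x by rewrite /W; have := normr_ge0 (Z x); lra.
  lra.
apply: (@le_trans _ _ ((`|b - a| + `|s - r|) * (C * W x) * (D * W x))).
  by apply: ler_pM.
by rewrite le_eqVlt; apply/orP; left; apply/eqP; rewrite /W; ring.
Qed.

Let prox_nd a (a0 : 0 < a) : {homo prox a h : x y / x <= y}.
Proof. by move=> x y; exact: prox_homo. Qed.

Let prox_lip a (a0 : 0 < a) x y : x <= y -> prox a h y - prox a h x <= y - x.
Proof. exact: prox_ler_sub. Qed.

Lemma prox_channel0 a w : prox_channel a 0 w = prox a h (B w).
Proof. by rewrite /prox_channel mul0r addr0. Qed.

(** The noiseless output is uncorrelated with Z. Subtracting it leaves the increment D = prox(B +
    rZ) - prox(B), to which firm nonexpansiveness D^2 <= D r Z applies. *)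
Lemma prox_corr_sub a r : 0 < a ->
  \int[m]_w (Z w * (prox_channel a r w - prox_channel a 0 w)) = prox_corr a r.
Proof.
move=> a0; under eq_Rintegral do rewrite mulrBr.
rewrite RintegralB//; [|exact: integrable_prox_corr|exact: integrable_prox_corr].
rewrite (_ : \int[m]_w (Z w * prox_channel a 0 w) = 0) ?subr0//.
under eq_Rintegral do rewrite prox_channel0.
by apply: EZf; [exact: prox_nd|exact: prox_lip].
Qed.

Let firm a r w : 0 < a -> (prox_channel a r w - prox_channel a 0 w) ^+ 2 <=
  (prox_channel a r w - prox_channel a 0 w) * (r * Z w).
Proof.
move=> a0; rewrite prox_channel0 /prox_channel.
have := prox_firmly_nonexpansive (B w) (B w + r * Z w) hcc a0.
by rewrite addrAC subrr add0r.
Qed.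

(** Pointwise, (rZ)^2 - r Z D = (rZ - D)^2 + (r Z D - D^2), and both summands are nonnegative, the
    second by firm nonexpansiveness. *)
Lemma prox_corr_le a r : 0 < a -> 0 < r -> prox_corr a r <= r.
Proof.
move=> a0 r0; rewrite -prox_corr_sub//.
rewrite -[leRHS]mulr1 -EZ2 -RintegralZl//.
have lxx := linear_growth_sub (lx r a0) (lx 0 a0).
apply: le_Rintegral => //; first exact: integrableM.
  by apply: (eq_integrable measurableT _ _ _ (integrableZl measurableT r Z2)) => w _.
move=> w _; have := firm r w a0.
move: (prox_channel a r w - prox_channel a 0 w) => D fD.
have : 0 <= (r * Z w - D) ^+ 2 by exact: sqr_ge0.
move=> sq; rewrite -(ler_pM2l r0); lra.
Qed.

(** Since E[Z B] = 0, N is also the correlation of Z with prox(B + rZ) - B; the bound expands the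
    mean square of the residual after projection on Z. *)
Lemma prox_corr_sqr_le a r : 0 < a -> prox_corr a r ^+ 2 <= prox_mse a r.
Proof.
move=> a0; set N := prox_corr a r.
have lxB := linear_growth_sub (lx r a0) lB.
have iZxB := integrableM lZ lxB.
have ZxB : \int[m]_w (Z w * (prox_channel a r w - B w)) = N.
  under eq_Rintegral do rewrite mulrBr.
  rewrite RintegralB//; [|exact: integrable_prox_corr|exact: integrableM].
  by rewrite (EZf (f := id))// subr0.
have : 0 <= \int[m]_w ((prox_channel a r w - B w - N * Z w) ^+ 2).
  by apply: Rintegral_ge0 => w _; exact: sqr_ge0.
rewrite (_ : \int[m]_w _ = \int[m]_w (((prox_channel a r w - B w) ^+ 2 -
    2 * N * (Z w * (prox_channel a r w - B w))) + N ^+ 2 * Z w ^+ 2)); last first.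
  by apply: eq_Rintegral => w _; ring.
have i1 := integrable_prox_mse r a0.
have i2 : m.-integrable setT (EFin \o (fun w => 2 * N * (Z w * (prox_channel a r w - B w)))).
  by apply: (eq_integrable measurableT _ _ _ (integrableZl measurableT (2 * N) iZxB)) => w _.
have i3 : m.-integrable setT (EFin \o (fun w => N ^+ 2 * Z w ^+ 2)).
  by apply: (eq_integrable measurableT _ _ _ (integrableZl measurableT (N ^+ 2) Z2)) => w _.
have i12 : m.-integrable setT (EFin \o (fun w => (prox_channel a r w - B w) ^+ 2 -
    2 * N * (Z w * (prox_channel a r w - B w)))).
  by apply: (eq_integrable measurableT _ _ _ (integrableB measurableT i1 i2)) => w _.
rewrite RintegralD// RintegralB// !RintegralZl// EZ2 ZxB -/(prox_mse a r).
lra.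
Qed.

(** The leading term is r E[Z prox] rather than r^2. With prox(B + rZ) - B = D + e and e = prox(B) -
    B, firm nonexpansiveness gives E[D^2] <= r E[Z D], while 2 D e <= 2 r |Z| |e| <= r (Z^2 + e^2).
    The constant K bounds E[e^2] uniformly over steps up to b. *)
Lemma prox_mse_le b : 0 < b -> exists2 K, 0 <= K & forall a r, 0 < a <= b -> 0 <= r ->
  prox_mse a r <= r * prox_corr a r + r * (1 + K) + K.
Proof.
move=> b0; pose P := `|prox b h 0|.
pose K := \int[m]_w (8 * P ^+ 2 + 8 * B w ^+ 2).
have iK : m.-integrable setT (EFin \o (fun w => 8 * P ^+ 2 + 8 * B w ^+ 2)).
  apply: (eq_integrable measurableT _ _ _ (integrableD measurableT
    (integrable_linear_growth_sqr m1 B2 Z2 (linear_growth_cst B Z (Num.sqrt (8 * P ^+ 2))))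
    (integrableZl measurableT 8 B2))) => w _ /=.
  by rewrite sqr_sqrtr// mulr_ge0// sqr_ge0.
exists K => [|a r ab r0].
  by apply: Rintegral_ge0 => w _; have := sqr_ge0 P; have := sqr_ge0 (B w); lra.
have a0 : 0 < a by case/andP: ab.
pose x0 := prox_channel a 0; pose D w := prox_channel a r w - x0 w.
pose e w := x0 w - B w.
have le : linear_growth B Z e by apply: linear_growth_sub => //; exact: lx.
have lD : linear_growth B Z D by apply: linear_growth_sub; exact: lx.
have ie := integrable_sqr le.
have iZD := integrableM lZ lD.
have eK : \int[m]_w (e w ^+ 2) <= K.
  apply: le_Rintegral => // w _.
  have pb : `|x0 w| <= 2 * P + `|B w| by rewrite /x0 prox_channel0; exact: prox_bound.
  have : `|e w| <= 2 * P + 2 * `|B w| by apply: le_trans (ler_normB _ _) _; lra.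
  have P0 : 0 <= P by exact: normr_ge0.
  have B0 := normr_ge0 (B w); have e0 := normr_ge0 (e w).
  rewrite -(real_normK (num_real (e w))) -(real_normK (num_real (B w))).
  move=> H; have : `|e w| ^+ 2 <= (2 * P + 2 * `|B w|) ^+ 2 by rewrite lerXn2r ?nnegrE//; lra.
  by have := sqr_ge0 (P - `|B w|); lra.
have i1 : m.-integrable setT (EFin \o (fun w => r * (Z w * D w))).
  by apply: (eq_integrable measurableT _ _ _ (integrableZl measurableT r iZD)) => w _.
have i2 : m.-integrable setT (EFin \o (fun w => r * Z w ^+ 2)).
  by apply: (eq_integrable measurableT _ _ _ (integrableZl measurableT r Z2)) => w _.
have i3 : m.-integrable setT (EFin \o (fun w => (1 + r) * e w ^+ 2)).
  by apply: (eq_integrable measurableT _ _ _ (integrableZl measurableT (1 + r) ie)) => w _.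
have i23 : m.-integrable setT (EFin \o (fun w => r * Z w ^+ 2 + (1 + r) * e w ^+ 2)).
  by apply: (eq_integrable measurableT _ _ _ (integrableD measurableT i2 i3)) => w _.
apply: (@le_trans _ _ (\int[m]_w (r * (Z w * D w) + (r * Z w ^+ 2 + (1 + r) * e w ^+ 2)))).
  apply: le_Rintegral => //; first exact: integrable_prox_mse.
    by apply: (eq_integrable measurableT _ _ _ (integrableD measurableT i1 i23)) => w _.
  move=> w _; have fD : D w ^+ 2 <= D w * (r * Z w) by exact: firm.
  rewrite (_ : prox_channel a r w - B w = D w + e w); last by rewrite /D /e; ring.
  have DZ : `|D w| <= r * `|Z w|.
    rewrite /D /x0 prox_channel0 /prox_channel.
    apply: le_trans (prox_nonexpansive _ _ hcc a0) _.
    by rewrite addrAC subrr add0r normrM ger0_norm.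
  have De : D w * e w <= r * `|Z w| * `|e w|.
    by apply: le_trans (ler_norm _) _; rewrite normrM ler_wpM2r.
  rewrite -(real_normK (num_real (Z w))).
  have : 0 <= r * (`|Z w| - `|e w|) ^+ 2 by rewrite mulr_ge0// sqr_ge0.
  rewrite -(real_normK (num_real (e w))).
  have : (D w + e w) ^+ 2 = D w ^+ 2 + 2 * (D w * e w) + `|e w| ^+ 2.
    by rewrite real_normK ?num_real//; ring.
  move=> ->; move: De fD; lra.
rewrite RintegralD// RintegralD// !RintegralZl// EZ2 prox_corr_sub//.
have : r * \int[m]_w (e w ^+ 2) <= r * K by rewrite ler_wpM2l.
lra.
Qed.

End ProxChannel.

(** * Resolvent moments of a bounded law *)

Lemma measurable_inv (R : realType) : measurable_fun setT (fun x : R => x^-1).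
Proof.
have -> : [set: R] = [set x | x != 0] `|` [set 0].
  by apply/seteqP; split => // x _; case: (eqVneq x 0) => [->|]; [right|left].
have o0 : open [set x : R | x != 0] by exact: open_neq.
apply/measurable_funU => //; first exact: open_measurable.
split; last exact: measurable_fun_set1.
apply: open_continuous_measurable_fun => // x /set_mem /= x0.
exact: inv_continuous.
Qed.

Section Resolvent.
Context d (T : measurableType d) (R : realType) (m : probability T R).
Variables (X : T -> R) (M : R).
Hypothesis mX : measurable_fun setT X.
Hypothesis X0 : forall w, 0 <= X w.
Hypothesis XM : forall w, X w <= M.
Hypothesis EX : 0 < \int[m]_w X w.

Let Y c w := (X w + c)^-1.

(** The Stieltjes transform of the law of [X] at -c; [stieltjes2] is minus its derivative in c. *)
Definition stieltjes (c : R) := \int[m]_w (X w + c)^-1.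
Definition stieltjes2 (c : R) := \int[m]_w ((X w + c)^-1 ^+ 2).

Lemma integrable_bounded (g : T -> R) (K : R) : measurable_fun setT g ->
  (forall w, `|g w| <= K) -> m.-integrable setT (EFin \o g).
Proof.
move=> mg gK.
apply: (@le_integrable _ _ _ m setT measurableT _ (EFin \o cst K)) => //.
- exact/measurable_EFinP.
- by move=> w _; rewrite lee_fin /= (le_trans (gK w))// ler_norm.
- exact: finite_measure_integrable_cst.
Qed.

Let Rcst (k : R) : \int[m]_w k = k.
Proof.
rewrite Rintegral_cst// -[RHS]mulr1 -[X in _ = _ * X]/(fine 1%E); congr (_ * fine _).
exact: probability_setT.
Qed.

Let mY c : measurable_fun setT (Y c).
Proof. by apply: (measurableT_comp (@measurable_inv R)); exact: measurable_funD. Qed.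

Let M0 : 0 <= M. Proof. exact: le_trans (X0 point) (XM point). Qed.

Let Xc0 c w : 0 < c -> 0 < X w + c.
Proof. by move=> c0; rewrite ltr_wpDl. Qed.

Let Y0 c w : 0 < c -> 0 < Y c w.
Proof. by move=> c0; rewrite invr_gt0 Xc0. Qed.

Let Yub c w : 0 < c -> Y c w <= c^-1.
Proof. by move=> c0; rewrite lef_pV2 ?posrE ?Xc0// lerDr. Qed.

Let Ylb c w : 0 < c -> (M + c)^-1 <= Y c w.
Proof. by move=> c0; rewrite lef_pV2 ?posrE ?Xc0// ?lerD2r// ltr_wpDl. Qed.

Let YK c w : 0 < c -> `|Y c w| <= c^-1.
Proof. by move=> c0; rewrite ger0_norm ?Yub// ltW// Y0. Qed.

Let iY c : 0 < c -> m.-integrable setT (EFin \o Y c).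
Proof. by move=> c0; apply: (integrable_bounded (K := c^-1)) => // w; exact: YK. Qed.

Let iY2 c : 0 < c -> m.-integrable setT (EFin \o (fun w => Y c w ^+ 2)).
Proof.
move=> c0; apply: (integrable_bounded (K := c^-1 ^+ 2)) => [|w].
  exact: measurable_funX.
by rewrite normrX lerXn2r ?nnegrE ?YK// invr_ge0 ltW.
Qed.

Let iXY2 c : 0 < c -> m.-integrable setT (EFin \o (fun w => X w * Y c w ^+ 2)).
Proof.
move=> c0; apply: (integrable_bounded (K := M * c^-1 ^+ 2)) => [|w].
  by apply: measurable_funM => //; exact: measurable_funX.
rewrite normrM normrX ger0_norm//; apply: ler_pM => //.
by rewrite lerXn2r ?nnegrE ?YK// invr_ge0 ltW.
Qed.

Let iX : m.-integrable setT (EFin \o X).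
Proof. by apply: (integrable_bounded (K := M)) => // w; rewrite ger0_norm. Qed.

Let icst k : m.-integrable setT (EFin \o (fun=> k : R)).
Proof. exact: finite_measure_integrable_cst. Qed.

Lemma stieltjes_lb c : 0 < c -> (M + c)^-1 <= stieltjes c.
Proof.
by move=> c0; rewrite -(Rcst (M + c)^-1); apply: le_Rintegral => //; [exact: iY|move=> w _; exact: Ylb].
Qed.

Lemma stieltjes_gt0 c : 0 < c -> 0 < stieltjes c.
Proof. by move=> c0; apply: lt_le_trans (stieltjes_lb c0); rewrite invr_gt0 ltr_wpDl. Qed.

Lemma stieltjes2_ub c : 0 < c -> stieltjes2 c <= c^-1 ^+ 2.
Proof.
move=> c0; rewrite -(Rcst (c^-1 ^+ 2)); apply: le_Rintegral => //; first exact: iY2.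
by move=> w _; rewrite lerXn2r ?nnegrE ?Yub// ?invr_ge0 ltW// Xc0.
Qed.

Lemma stieltjes2_lb c : 0 < c -> (M + c)^-1 ^+ 2 <= stieltjes2 c.
Proof.
move=> c0; rewrite -(Rcst ((M + c)^-1 ^+ 2)); apply: le_Rintegral => //; first exact: iY2.
have Mc : 0 < M + c by rewrite ltr_wpDl.
by move=> w _; rewrite lerXn2r ?nnegrE ?Ylb// ?invr_ge0 ltW// Xc0.
Qed.

Lemma stieltjes2_gt0 c : 0 < c -> 0 < stieltjes2 c.
Proof.
by move=> c0; apply: lt_le_trans (stieltjes2_lb c0); rewrite exprn_gt0// invr_gt0 ltr_wpDl.
Qed.

(** Used at two centres: the mean of [Y c] gives the Cauchy-Schwarz bound, and 1/c gives the decay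
    of the variance. *)
Let centered c k : 0 < c ->
  \int[m]_w ((Y c w - k) ^+ 2) = stieltjes2 c - 2 * k * stieltjes c + k ^+ 2.
Proof.
move=> c0; have i1 := iY2 c0; have i2 := iY c0.
have i3 : m.-integrable setT (EFin \o (fun w => 2 * k * Y c w)).
  by apply: (eq_integrable measurableT _ _ _ (integrableZl measurableT (2 * k) i2)) => w _.
have i13 : m.-integrable setT (EFin \o (fun w => Y c w ^+ 2 - 2 * k * Y c w)).
  by apply: (eq_integrable measurableT _ _ _ (integrableB measurableT i1 i3)) => w _.
rewrite (_ : \int[m]_w _ = \int[m]_w (Y c w ^+ 2 - 2 * k * Y c w + k ^+ 2)).
  by rewrite RintegralD//; rewrite RintegralB// RintegralZl// Rcst.
by apply: eq_Rintegral => w _; ring.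
Qed.

Lemma stieltjes_sqr_le c : 0 < c -> stieltjes c ^+ 2 <= stieltjes2 c.
Proof.
move=> c0; have := centered (stieltjes c) c0.
have : 0 <= \int[m]_w ((Y c w - stieltjes c) ^+ 2).
  by apply: Rintegral_ge0 => w _; exact: sqr_ge0.
by move=> + E; rewrite E; lra.
Qed.

(** The variance is at most the second moment about 1/c, and Y - 1/c = - X Y / c is of order c^-2.
    The rate c^-4 is exactly what keeps 1/G^2 - 1/H bounded for large c. *)
Lemma stieltjes_variance_le c : 0 < c ->
  stieltjes2 c - stieltjes c ^+ 2 <= M ^+ 2 / c ^+ 4.
Proof.
move=> c0; have := centered c^-1 c0.
have : \int[m]_w ((Y c w - c^-1) ^+ 2) <= M ^+ 2 / c ^+ 4.
  have key w : (Y c w - c^-1) ^+ 2 <= M ^+ 2 / c ^+ 4.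
    have c4 : 0 <= (c ^+ 4)^-1 by rewrite invr_ge0 exprn_ge0// ltW.
    have Yc0 := Y0 w c0; have Ycu := Yub w c0.
    rewrite (_ : Y c w - c^-1 = - (X w * Y c w / c)); last first.
      by rewrite /Y; field; rewrite !gt_eqF// Xc0.
    rewrite sqrrN expr_div_n.
    rewrite (_ : M ^+ 2 / c ^+ 4 = (M * c^-1) ^+ 2 / c ^+ 2); last first.
      by field; rewrite gt_eqF.
    apply: ler_wpM2r; first by rewrite invr_ge0 sqr_ge0.
    have cV : 0 <= c^-1 by rewrite invr_ge0 ltW.
    rewrite lerXn2r ?nnegrE; [|exact: mulr_ge0 (ltW _)|exact: mulr_ge0|] => //.
    by apply: ler_pM => //; exact: ltW.
  rewrite -[leRHS]Rcst; apply: le_Rintegral => //.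
  apply: (integrable_bounded (K := M ^+ 2 / c ^+ 4)).
    by apply: measurable_funX; exact: measurable_funB.
  by move=> w; rewrite ger0_norm ?sqr_ge0.
move=> h1 h2; rewrite h2 in h1; apply: le_trans h1.
by have := sqr_ge0 (stieltjes c - c^-1); lra.
Qed.

Lemma Rintegral_resolvent c : 0 < c ->
  \int[m]_w (X w * (X w + c)^-1 ^+ 2) = stieltjes c - c * stieltjes2 c.
Proof.
move=> c0; have i1 := iY2 c0; have i2 := iY c0.
have i3 : m.-integrable setT (EFin \o (fun w => c * Y c w ^+ 2)).
  by apply: (eq_integrable measurableT _ _ _ (integrableZl measurableT c i1)) => w _.
rewrite (_ : \int[m]_w _ = \int[m]_w (Y c w - c * Y c w ^+ 2)).
  by rewrite RintegralB// RintegralZl.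
by apply: eq_Rintegral => w _; rewrite /Y; field; rewrite gt_eqF// Xc0.
Qed.

Lemma Rintegral_affine_resolvent a b c : 0 < c ->
  \int[m]_w ((a * X w + b) / (X w + c) ^+ 2) =
  a * (stieltjes c - c * stieltjes2 c) + b * stieltjes2 c.
Proof.
move=> c0; have i1 := iXY2 c0; have i2 := iY2 c0.
have i3 : m.-integrable setT (EFin \o (fun w => a * (X w * Y c w ^+ 2))).
  by apply: (eq_integrable measurableT _ _ _ (integrableZl measurableT a i1)) => w _.
have i4 : m.-integrable setT (EFin \o (fun w => b * Y c w ^+ 2)).
  by apply: (eq_integrable measurableT _ _ _ (integrableZl measurableT b i2)) => w _.
rewrite (_ : \int[m]_w _ = \int[m]_w (a * (X w * Y c w ^+ 2) + b * Y c w ^+ 2)).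
  by rewrite RintegralD// !RintegralZl// Rintegral_resolvent.
by apply: eq_Rintegral => w _; rewrite /Y exprVn; ring.
Qed.

(** The left-hand factor bounds (X + c)^-2 from below, so positivity of the mean of [X] becomes a
    quantitative lower bound. *)
Lemma stieltjes_resolvent_lb c : 0 < c ->
  (M + c)^-1 ^+ 2 * \int[m]_w X w <= stieltjes c - c * stieltjes2 c.
Proof.
move=> c0; rewrite -Rintegral_resolvent// -RintegralZl//.
have Mc : 0 < M + c by rewrite ltr_wpDl.
apply: le_Rintegral => //; last first.
- move=> w _; rewrite mulrC; apply: ler_wpM2l => //.
  by apply: lerXn2r; rewrite ?nnegrE; [rewrite invr_ge0 ltW|exact/ltW/Y0|exact: Ylb].
- exact: iXY2.
- by apply: (eq_integrable measurableT _ _ _ (integrableZl measurableT ((M + c)^-1 ^+ 2) iX)) => w _.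
Qed.

Lemma stieltjes_resolvent_gt0 c : 0 < c -> 0 < stieltjes c - c * stieltjes2 c.
Proof.
move=> c0; apply: lt_le_trans (stieltjes_resolvent_lb c0).
by rewrite mulr_gt0// exprn_gt0// invr_gt0 ltr_wpDl.
Qed.

Lemma stieltjes_resolvent_ub c : 0 < c ->
  stieltjes c - c * stieltjes2 c <= M * stieltjes2 c.
Proof.
move=> c0; have i1 := iY2 c0; rewrite -Rintegral_resolvent// -RintegralZl//.
apply: le_Rintegral => //; first exact: iXY2.
  by apply: (eq_integrable measurableT _ _ _ (integrableZl measurableT M i1)) => w _.
by move=> w _; rewrite ler_wpM2r ?sqr_ge0.
Qed.

(** With G and H the two moments, c G^2 <= c H < G; then G is cancelled. *)
Lemma stieltjes_mul_lt1 c : 0 < c -> c * stieltjes c < 1.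
Proof.
move=> c0; have h1 := stieltjes_resolvent_gt0 c0; have h2 := stieltjes_sqr_le c0.
have h3 := stieltjes_gt0 c0; rewrite -(ltr_pM2l h3) mulr1.
have : c * stieltjes c ^+ 2 <= c * stieltjes2 c by rewrite ler_pM2l.
lra.
Qed.

(** By the resolvent identity the difference of the integrands is at least the positive constant
    [k], which keeps the inequality strict after integration. *)
Lemma stieltjes_decreasing c c' : 0 < c -> c < c' -> stieltjes c' < stieltjes c.
Proof.
move=> c0 cc'; have c'0 : 0 < c' := lt_trans c0 cc'.
have i1 := iY c0; have i2 := iY c'0; rewrite -subr_gt0 -RintegralB//.
have Mc : 0 < M + c by rewrite ltr_wpDl.
have Mc' : 0 < M + c' by rewrite ltr_wpDl.
pose k := (c' - c) * ((M + c)^-1 * (M + c')^-1).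
have k0 : 0 < k by rewrite !mulr_gt0 ?subr_gt0 ?invr_gt0.
apply: (lt_le_trans k0); rewrite -(Rcst k); apply: le_Rintegral => //.
  by apply: (eq_integrable measurableT _ _ _ (integrableB measurableT i1 i2)) => w _.
move=> w _; rewrite (_ : (X w + c)^-1 - _ = (c' - c) * (Y c w * Y c' w)); last first.
  by rewrite /Y; field; rewrite !gt_eqF// Xc0.
rewrite ler_wpM2l ?subr_ge0 ?(ltW cc')// ler_pM ?Ylb ?invr_ge0 ?ltW//.
Qed.

Let Ydist c c' w : 0 < c -> c / 2 < c' -> `|Y c' w - Y c w| <= `|c' - c| * (2 / c ^+ 2).
Proof.
move=> c0 cc'; have c'0 : 0 < c' by lra.
rewrite (_ : Y c' w - Y c w = - ((c' - c) * (Y c w * Y c' w))); last first.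
  by rewrite /Y; field; rewrite !gt_eqF// Xc0.
rewrite normrN normrM ler_wpM2l//.
rewrite ger0_norm; last by rewrite mulr_ge0// ltW// Y0.
rewrite (_ : 2 / c ^+ 2 = c^-1 * (2 / c)); last by field; rewrite gt_eqF.
apply: ler_pM; rewrite ?Yub// ?(ltW (Y0 _ _))//.
apply: le_trans (Yub w c'0) _.
by rewrite -[2 / c]invrK invf_div lef_pV2 ?posrE ?divr_gt0// ltW.
Qed.

Lemma continuous_stieltjes c : 0 < c -> {for c, continuous stieltjes}.
Proof.
move=> c0; apply/cvgrPdist_le => e e0; near=> c'.
have cc' : c / 2 < c' by near: c'; apply: lt_nbhsr; lra.
have c'0 : 0 < c' by lra.
have i1 := iY c0; have i2 := iY c'0.
have i21 : m.-integrable setT (EFin \o (fun w => Y c' w - Y c w)).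
  by apply: (eq_integrable measurableT _ _ _ (integrableB measurableT i2 i1)) => w _.
rewrite distrC -RintegralB//; apply: le_trans (le_normr_Rintegral measurableT i21) _.
have : `|c - c'| <= e / (2 / c ^+ 2).
  near: c'; apply: cvgr_dist_le; first exact: cvg_id.
  by rewrite !divr_gt0// exprn_gt0.
rewrite ler_pdivlMr ?divr_gt0 ?exprn_gt0// => h; apply: le_trans h.
rewrite -[leRHS]Rcst; apply: le_Rintegral => //; first exact: integrable_norm.
by move=> w _; rewrite (distrC c); exact: Ydist.
Unshelve. all: by end_near. Qed.

Lemma continuous_stieltjes2 c : 0 < c -> {for c, continuous stieltjes2}.
Proof.
move=> c0; pose k := 2 / c ^+ 2 * (3 / c).
have k0 : 0 < k by rewrite mulr_gt0 ?divr_gt0// exprn_gt0.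
apply/cvgrPdist_le => e e0; near=> c'.
have cc' : c / 2 < c' by near: c'; apply: lt_nbhsr; lra.
have c'0 : 0 < c' by lra.
have i1 := iY2 c0; have i2 := iY2 c'0.
have i21 : m.-integrable setT (EFin \o (fun w => Y c' w ^+ 2 - Y c w ^+ 2)).
  by apply: (eq_integrable measurableT _ _ _ (integrableB measurableT i2 i1)) => w _.
rewrite distrC -RintegralB//; apply: le_trans (le_normr_Rintegral measurableT i21) _.
have : `|c - c'| <= e / k.
  near: c'; apply: cvgr_dist_le; first exact: cvg_id.
  by rewrite divr_gt0.
rewrite ler_pdivlMr// => h; apply: le_trans h.
rewrite -[leRHS]Rcst; apply: le_Rintegral => //; first exact: integrable_norm.
move=> w _; rewrite subr_sqr normrM [leRHS]mulrA; apply: ler_pM => //.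
  by rewrite (distrC c); exact: Ydist.
rewrite ger0_norm; last by apply: addr_ge0; apply/ltW/Y0.
have := Yub w c0; have := Yub w c'0.
have : c'^-1 <= 2 / c by rewrite -[2 / c]invrK invf_div lef_pV2 ?posrE ?divr_gt0// ltW.
lra.
Unshelve. all: by end_near. Qed.

(** The left-hand side is the mean of (X + l) / (X + c). *)
Lemma stieltjes_affine_le c l : 0 < c -> 0 < l ->
  1 + (l - c) * stieltjes c <= (M + l) / c.
Proof.
move=> c0 l0; have i1 := iY c0.
have i2 : m.-integrable setT (EFin \o (fun w => (l - c) * Y c w)).
  by apply: (eq_integrable measurableT _ _ _ (integrableZl measurableT (l - c) i1)) => w _.
rewrite -[leRHS]Rcst -[X in X + _]Rcst -RintegralZl// -RintegralD//.
apply: le_Rintegral => //.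
  by apply: (eq_integrable measurableT _ _ _ (integrableD measurableT (icst 1) i2)) => w _.
move=> w _; rewrite (_ : 1 + _ = (X w + l) * Y c w); last first.
  by rewrite /Y; field; rewrite gt_eqF// Xc0.
apply: ler_pM; rewrite ?(ltW (Y0 _ _)) ?Yub ?lerD2r//.
by rewrite addr_ge0// ltW.
Qed.

End Resolvent.

(** * The reduced fixed-point system *)

(* [G c] and [H c] abstract the first two moments of 1/(S + c), [N a r] the
   correlation E[Z prox_{ah}(B + rZ)] and [U a r] the error
   E[(prox_{ah}(B + rZ) - B)^2].  The unknowns are [c = eta - gamma1] and
   [t = gamma1^2 tau1]; [gam] is gamma1. *)
Section FixedPointSystem.
Context {R : realType}.
Variables (M lam sig2 ES : R) (G H : R -> R) (N U : R -> R -> R).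
Hypotheses (M0 : 0 <= M) (lam0 : 0 < lam) (sig0 : 0 < sig2) (ES0 : 0 < ES).
Hypothesis cG : forall c : R, 0 < c -> {for c, continuous G}.
Hypothesis cH : forall c : R, 0 < c -> {for c, continuous H}.
Hypothesis G_lb : forall c : R, 0 < c -> (M + c)^-1 <= G c.
Hypothesis cG_lt1 : forall c : R, 0 < c -> c * G c < 1.
Hypothesis H_lb : forall c : R, 0 < c -> (M + c)^-1 ^+ 2 <= H c.
Hypothesis H_ub : forall c : R, 0 < c -> H c <= c^-1 ^+ 2.
Hypothesis G_sqr : forall c : R, 0 < c -> G c ^+ 2 <= H c.
Hypothesis GH_var : forall c : R, 0 < c -> H c - G c ^+ 2 <= M ^+ 2 / c ^+ 4.
Hypothesis GH_lb : forall c : R, 0 < c -> (M + c)^-1 ^+ 2 * ES <= G c - c * H c.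
Hypothesis GH_ub : forall c : R, 0 < c -> G c - c * H c <= M * H c.
Hypothesis G_decay : forall c : R, 0 < c -> 1 + (lam - c) * G c <= (M + lam) / c.
Hypothesis cN : forall a r : R, 0 < a -> {for (a, r), continuous (fun p => N p.1 p.2)}.
Hypothesis cU : forall a r : R, 0 < a -> {for (a, r), continuous (fun p => U p.1 p.2)}.
Hypothesis N_le : forall a r : R, 0 < a -> 0 < r -> N a r <= r.
Hypothesis N_gt0 : forall a r : R, 0 < a -> 0 < r -> 0 < N a r.
Hypothesis U_ge0 : forall a r : R, 0 <= U a r.
Hypothesis U_le : forall b : R, 0 < b -> exists2 K, 0 <= K & forall a r : R, 0 < a <= b -> 0 <= r ->
  U a r <= r * N a r + r * (1 + K) + K.

Lemma lef_pV2_gt0 (x y : R) : 0 < x -> 0 < y -> (x^-1 <= y^-1) = (y <= x).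
Proof. by move=> x0 y0; rewrite lef_pV2. Qed.

(** With S the spectral variable, [level c] is E[(S + lam) / (S + c)], [mean c] is the mean of S
    reweighted by the density proportional to 1/(S + c)^2, and [gap c] is the variance of 1/(S + c)
    divided by G^2 H. The scale of the proximal map is [step c]. *)
Let gam (c : R) : R := (G c)^-1 - c.
Let step (c : R) : R := (lam + gam c)^-1.
Let level (c : R) : R := 1 + (lam - c) * G c.
Let mean (c : R) : R := G c / H c - c.
Let gap (c : R) : R := (G c ^+ 2)^-1 - (H c)^-1.

Lemma fixed_point_G_gt0 (c : R) : 0 < c -> 0 < G c.
Proof. by move=> c0; apply: lt_le_trans (G_lb c0); rewrite invr_gt0 ltr_wpDl. Qed.

Lemma fixed_point_H_gt0 (c : R) : 0 < c -> 0 < H c.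
Proof. by move=> c0; apply: lt_le_trans (H_lb c0); rewrite exprn_gt0// invr_gt0 ltr_wpDl. Qed.

(** When G is the mean of 1/(S + c), its reciprocal is the harmonic mean of S + c, so subtracting c
    leaves a value between the extremes of S. *)
Lemma fixed_point_gam_bounds (c : R) : 0 < c -> 0 < gam c <= M.
Proof.
move=> c0; have Gc0 := fixed_point_G_gt0 c0; apply/andP; split.
  rewrite /gam subr_gt0 -(ltr_pM2r Gc0) mulVf ?gt_eqF//; exact: cG_lt1.
suff : (G c)^-1 <= M + c by rewrite /gam lerBlDr.
by rewrite -[leRHS]invrK lef_pV2 ?posrE ?invr_gt0 ?ltr_wpDl// G_lb.
Qed.

Lemma fixed_point_step_bounds (c : R) : 0 < c -> (lam + M)^-1 <= step c <= lam^-1.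
Proof.
have [M0' lam0'] := (M0, lam0).
move=> c0; have /andP[g0 gM] := fixed_point_gam_bounds c0.
by rewrite /step; apply/andP; split; rewrite lef_pV2_gt0; lra.
Qed.

Lemma fixed_point_step_gt0 (c : R) : 0 < c -> 0 < step c.
Proof.
by move=> c0; have /andP[g0 gM] := fixed_point_gam_bounds c0; rewrite invr_gt0 addr_gt0.
Qed.

Lemma fixed_point_level_step (c : R) : 0 < c -> level c * step c = G c.
Proof.
have [M0' lam0'] := (M0, lam0).
move=> c0; have /andP[g0 gM] := fixed_point_gam_bounds c0; have Gc0 := fixed_point_G_gt0 c0.
rewrite /level (_ : 1 + _ = G c * (lam + gam c)).
  by rewrite -mulrA mulfV ?mulr1// gt_eqF//; lra.
by rewrite /gam; field; rewrite gt_eqF.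
Qed.

Lemma fixed_point_mean_ub (c : R) : 0 < c -> mean c <= M.
Proof.
move=> c0; have Hc0 := fixed_point_H_gt0 c0; rewrite -(ler_pM2r Hc0) /mean mulrBl divfK ?gt_eqF//.
exact: GH_ub.
Qed.

(** The numerator of [mean] is at least ES / (M + c)^2 and H is at most 1/c^2; the ratio c / (M + c)
    is smallest at c = lam. *)
Lemma fixed_point_mean_lb (c : R) : lam <= c -> ES * (lam / (M + lam)) ^+ 2 <= mean c.
Proof.
have [M0' lam0'] := (M0, lam0).
move=> lc; have c0 : 0 < c by lra.
have Hc0 := fixed_point_H_gt0 c0; have Mc : 0 < M + c by lra.
have Ml : 0 < M + lam by lra.
apply: (@le_trans _ _ (ES * (c / (M + c)) ^+ 2)).
  rewrite ler_wpM2l ?(ltW ES0)//; apply: lerXn2r; rewrite ?nnegrE.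
  - by rewrite divr_ge0 ?ltW.
  - by rewrite divr_ge0 ?ltW.
  - by rewrite ler_pdivrMr// mulrAC ler_pdivlMr//; nra.
rewrite -(ler_pM2r Hc0) /mean mulrBl divfK ?gt_eqF//.
apply: le_trans (GH_lb c0).
rewrite (_ : ES * _ * _ = (M + c)^-1 ^+ 2 * ES * (c ^+ 2 * H c)); last by ring.
apply: ler_piMr; first by rewrite mulr_ge0 ?sqr_ge0 ?(ltW ES0).
apply: (@le_trans _ _ (c ^+ 2 * c^-1 ^+ 2)).
  by rewrite ler_wpM2l ?sqr_ge0// H_ub.
by rewrite -exprMn mulfV ?expr1n// gt_eqF.
Qed.

Lemma fixed_point_gap_ge0 (c : R) : 0 < c -> 0 <= gap c.
Proof.
by move=> c0; rewrite subr_ge0 lef_pV2 ?posrE ?G_sqr ?fixed_point_H_gt0// exprn_gt0 ?fixed_point_G_gt0.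
Qed.

(** In gap = (H - G^2) / (G^2 H) the numerator decays like c^-4, which offsets the growth of 1/(G^2
    H) like c^4. *)
Lemma fixed_point_gap_ub (c : R) : lam <= c -> gap c <= M ^+ 2 * (1 + M / lam) ^+ 4.
Proof.
have [M0' lam0'] := (M0, lam0).
move=> lc; have c0 : 0 < c by lra.
have Gc0 := fixed_point_G_gt0 c0; have Hc0 := fixed_point_H_gt0 c0.
have Mc : 0 < M + c by lra.
have -> : gap c = (H c - G c ^+ 2) * ((G c ^+ 2)^-1 * (H c)^-1).
  by rewrite /gap; field; rewrite !gt_eqF.
apply: (@le_trans _ _ (M ^+ 2 / c ^+ 4 * ((M + c) ^+ 2 * (M + c) ^+ 2))).
  have Mc2 : 0 < (M + c)^-1 by rewrite invr_gt0.
  have q1 : (G c ^+ 2)^-1 <= (M + c) ^+ 2.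
    rewrite -[leRHS]invrK lef_pV2_gt0 ?invr_gt0 ?exprn_gt0// -exprVn.
    by apply: lerXn2r; rewrite ?nnegrE ?G_lb// ltW.
  have q2 : (H c)^-1 <= (M + c) ^+ 2.
    by rewrite -[leRHS]invrK lef_pV2_gt0 ?invr_gt0 ?exprn_gt0// -exprVn H_lb.
  have q3 : 0 <= (G c ^+ 2)^-1 by rewrite invr_ge0 sqr_ge0.
  have q4 : 0 <= (H c)^-1 by rewrite invr_ge0 ltW.
  apply: ler_pM; [by rewrite subr_ge0 G_sqr|exact: mulr_ge0|exact: GH_var|exact: ler_pM].
rewrite (_ : M ^+ 2 / c ^+ 4 * _ = M ^+ 2 * (1 + M / c) ^+ 4); last first.
  by field; rewrite gt_eqF.
apply: ler_wpM2l; first exact: sqr_ge0.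
apply: lerXn2r; rewrite ?nnegrE.
- by rewrite addr_ge0// divr_ge0// ltW.
- by rewrite addr_ge0// divr_ge0// ltW.
- by rewrite lerD2l; apply: ler_wpM2l => //; rewrite lef_pV2_gt0.
Qed.

(** The contraction constant of the system. Since step * level = G and gap * G = gam - mean, the
    product is (gam - mean) * step <= gam * step = 1 - lam * step. *)
Lemma fixed_point_gap_level (c : R) : 0 < c ->
  gap c * (step c ^+ 2 * level c) <= 1 - lam / (lam + M).
Proof.
have [M0' lam0'] := (M0, lam0).
move=> c0; have Gc0 := fixed_point_G_gt0 c0; have Hc0 := fixed_point_H_gt0 c0.
have a0 := fixed_point_step_gt0 c0.
have /andP[g0 gM] := fixed_point_gam_bounds c0; have /andP[al au] := fixed_point_step_bounds c0.
have m0 : 0 <= mean c.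
  rewrite -(ler_pM2r Hc0) mul0r /mean mulrBl divfK ?gt_eqF//.
  by apply: le_trans (GH_lb c0); rewrite mulr_ge0 ?sqr_ge0 ?ltW.
have -> : step c ^+ 2 * level c = step c * G c.
  by rewrite -(fixed_point_level_step c0); ring.
have -> : gap c * (step c * G c) = (gam c - mean c) * step c.
  by rewrite /gap /mean /gam; field; rewrite !gt_eqF.
apply: (@le_trans _ _ (gam c * step c)).
  by apply: ler_wpM2r; [exact: ltW|lra].
have -> : gam c * step c = 1 - lam * step c.
  have e : (lam + gam c) * step c = 1 by rewrite mulfV// gt_eqF//; lra.
  by rewrite -[in RHS]e; ring.
by rewrite lerD2l lerN2 ler_wpM2l// ltW.
Qed.

(* The last term of [eqII] vanishes where [eqI] does and at [t = t0].  Near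
   [t = t1] it trades the part r N of the growth of [U] for r^2 [level], whose
   coefficient [gap * step^2 * level] stays below 1. *)
Let eqI (p : R * R) : R :=
  N (step p.1) (step p.1 * Num.sqrt p.2) - step p.1 * Num.sqrt p.2 * level p.1.
Let eqII (t0 : R) (p : R * R) : R :=
  sig2 * mean p.1 + gap p.1 * U (step p.1) (step p.1 * Num.sqrt p.2) - p.2
  - gap p.1 * ((1 - t0 / p.2) * (step p.1 * Num.sqrt p.2 * eqI p)).

Lemma continuous_fixed_point_eqs (t0 : R) (p : R * R) : 0 < p.1 -> 0 < p.2 ->
  {for p, continuous eqI} /\ {for p, continuous (eqII t0)}.
Proof.
have [M0' lam0'] := (M0, lam0).
case: p => c t /= c0 t0'; set p := (c, t).
have Gc0 := fixed_point_G_gt0 c0; have Hc0 := fixed_point_H_gt0 c0.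
have /andP[g0 gM] := fixed_point_gam_bounds c0.
have c1 : (q.1 @[q --> p]) --> c by exact: cvg_fst.
have c2 : (q.2 @[q --> p]) --> t by exact: cvg_snd.
have kG : G q.1 @[q --> p] --> G c by apply: (cvg_comp _ _ c1); exact: cG.
have kH : H q.1 @[q --> p] --> H c by apply: (cvg_comp _ _ c1); exact: cH.
have ks : Num.sqrt q.2 @[q --> p] --> Num.sqrt t.
  by apply: (cvg_comp _ _ c2); exact: sqrt_continuous.
have ka : step q.1 @[q --> p] --> step c.
  apply: cvgV; first by rewrite gt_eqF//; lra.
  apply: cvgD; first exact: cvg_cst.
  by apply: cvgB => //; apply: cvgV => //; rewrite gt_eqF.
have kl : level q.1 @[q --> p] --> level c.
  apply: cvgD; first exact: cvg_cst.
  by apply: cvgM => //; apply: cvgB => //; exact: cvg_cst.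
have kr : step q.1 * Num.sqrt q.2 @[q --> p] --> step c * Num.sqrt t by exact: cvgM.
have kar : (step q.1, step q.1 * Num.sqrt q.2) @[q --> p] --> (step c, step c * Num.sqrt t).
  exact: (cvg_pair ka kr).
have kN : N (step q.1) (step q.1 * Num.sqrt q.2) @[q --> p] --> N (step c) (step c * Num.sqrt t).
  exact: (cvg_comp _ _ kar (cN (fixed_point_step_gt0 c0))).
have kU : U (step q.1) (step q.1 * Num.sqrt q.2) @[q --> p] --> U (step c) (step c * Num.sqrt t).
  exact: (cvg_comp _ _ kar (cU (fixed_point_step_gt0 c0))).
have k1 : {for p, continuous eqI}.
  by apply: cvgB => //; exact: cvgM.
have km : mean q.1 @[q --> p] --> mean c.
  by apply: cvgB => //; apply: cvgM => //; apply: cvgV => //; rewrite gt_eqF.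
have kg : gap q.1 @[q --> p] --> gap c.
  apply: cvgB; apply: cvgV => //; rewrite ?gt_eqF// ?exprn_gt0//.
  exact: (cvgM kG kG).
split => //; apply: cvgB; last first.
  apply: cvgM => //; apply: cvgM; last exact: cvgM.
  apply: cvgB; first exact: cvg_cst.
  by apply: cvgM; [exact: cvg_cst|apply: cvgV => //; rewrite gt_eqF].
apply: cvgB => //; apply: cvgD; apply: cvgM => //; exact: cvg_cst.
Qed.

Lemma fixed_point_system_solvable : exists c t : R, [/\ 0 < c, 0 < t,
  N (step c) (step c * Num.sqrt t) = step c * Num.sqrt t * level c &
  t = sig2 * mean c + gap c * U (step c) (step c * Num.sqrt t)].
Proof.
have [M0' lam0' sig0' ES0'] := And4 M0 lam0 sig0 ES0.
have lV : 0 < lam^-1 by rewrite invr_gt0.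
have [K K0 UK] := U_le lV.
(* Half of the lower bound of sig2 * [mean] on c >= lam, so that [eqII] is positive on the side t =
   t0. *)
pose t0 := sig2 * (ES * (lam / (M + lam)) ^+ 2) / 2.
have lM : 0 < M + lam by lra.
have t00 : 0 < t0.
  by rewrite divr_gt0// mulr_gt0// mulr_gt0// exprn_gt0// divr_gt0.
pose V := M ^+ 2 * (1 + M / lam) ^+ 4.
have V0 : 0 <= V by rewrite mulr_ge0 ?sqr_ge0// exprn_ge0// addr_ge0// divr_ge0// ltW.
(* On the side t = t1 = s1^2 the right-hand side of the second equation, corrected as in [eqII],
   will be at most A + A' s1 + (1 - kap) t1, where [V] bounds [gap]. *)
pose A := sig2 * M + V * (t0 / lam ^+ 2 + K).
pose A' := V * (1 + K) / lam.
have A0 : 0 <= A.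
  apply: addr_ge0; first by rewrite mulr_ge0// ltW.
  by rewrite mulr_ge0 ?addr_ge0// divr_ge0 ?sqr_ge0// ltW.
have A'0 : 0 <= A' by rewrite divr_ge0 ?(ltW lam0)// mulr_ge0 ?addr_ge0.
pose kap := lam / (lam + M).
have kap0 : 0 < kap by rewrite divr_gt0//; lra.
(* The quotient gives A + A' s1 <= kap s1^2; the other summands ensure s1 >= 1 and t1 > t0. *)
pose s1 := (A + A' + 1) / kap + 1 + t0.
have s1kap : A + A' + 1 <= kap * s1.
  have : 0 <= kap * (1 + t0) by rewrite mulr_ge0 ?addr_ge0 ?(ltW kap0) ?(ltW t00).
  have -> : kap * s1 = (A + A' + 1) + kap * (1 + t0).
    by rewrite /s1 -addrA mulrDr [kap * (_ / _)]mulrC divfK ?gt_eqF.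
  by rewrite lerDl.
have s1t0 : 1 + t0 <= s1.
  have : 0 <= (A + A' + 1) / kap by apply: divr_ge0; [apply: addr_ge0 => //; exact: addr_ge0|exact: ltW].
  rewrite /s1; lra.
pose t1 := s1 ^+ 2.
have t01 : t0 < t1 by rewrite /t1; nra.
have t10 : 0 < t1 by lra.
have s1E : Num.sqrt t1 = s1 by rewrite sqrtr_sqr ger0_norm//; lra.
pose r0 := (lam + M)^-1 * Num.sqrt t0; pose r1 := lam^-1 * s1.
have lMV : 0 < (lam + M)^-1 by rewrite invr_gt0; lra.
have sq0 : 0 < Num.sqrt t0 by rewrite sqrtr_gt0.
have r00 : 0 < r0 by rewrite mulr_gt0.
have lMl : (lam + M)^-1 <= lam^-1 by rewrite lef_pV2_gt0; lra.
have sqs1 : Num.sqrt t0 <= s1 by rewrite -s1E ler_wsqrtr// ltW.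
have r01 : r0 <= r1 by apply: ler_pM => //; exact: ltW.
(* [step] stays in a fixed compact interval for every c > 0, so r0 and r1 are chosen independently
   of c. Compactness then makes positivity of [N] uniform before the right end c1 is fixed. *)
have [nu nu0 Nnu] : exists2 nu : R, 0 < nu & forall a r : R, (lam + M)^-1 <= a <= lam^-1 ->
    r0 <= r <= r1 -> nu <= N a r.
  pose S := `[(lam + M)^-1, lam^-1]%classic `*` `[r0, r1]%classic.
  have cS : compact S by apply: compact_setX; exact: segment_compact.
  have S0 : S !=set0 by exists ((lam + M)^-1, r0); split; rewrite /= in_itv /= lexx.
  have cNS : {within S, continuous (fun p : R * R => N p.1 p.2)}.
    apply: continuous_in_subspaceT => -[a r] /set_mem[/=]; rewrite !in_itv /= => /andP[a1 _] _.
    by apply: cN; lra.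
  have [[a r] /set_mem[/=]] := compact_EVT_min S0 cS cNS.
  rewrite !in_itv /= => /andP[a1 _] /andP[rr0 _] amin.
  exists (N a r); first by apply: N_gt0; lra.
  by move=> a' r' aI rI; apply: (amin (a', r')); apply/mem_set; split; rewrite /= in_itv.
(* By [G_decay], r times [level] at c1 is at most r1 (M + lam) / c1, which this choice puts below
   nu. *)
pose c1 := lam + 1 + r1 * (M + lam) / nu.
have r10 : 0 < r1 by lra.
have c1lam : lam + 1 <= c1 by rewrite lerDl; apply: divr_ge0; [apply: mulr_ge0|]; exact: ltW.
have c10 : 0 < c1 by lra.
have radius (c t : R) : 0 < c -> t0 <= t <= t1 -> r0 <= step c * Num.sqrt t <= r1.
  move=> c0 /andP[tt0 tt1]; have /andP[sl su] := fixed_point_step_bounds c0.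
  have s0 := fixed_point_step_gt0 c0.
  apply/andP; split; apply: ler_pM; rewrite ?sqrtr_ge0 ?ler_wsqrtr ?(ltW lMV) ?(ltW s0)//.
  by rewrite -s1E ler_wsqrtr.
have [p [p1 p2 e1 e2]] : exists p, [/\ lam <= p.1 <= c1, t0 <= p.2 <= t1, eqI p = 0 & eqII t0 p = 0].
  apply: (@poincare_miranda R eqI (eqII t0) lam c1 t0 t1) => //.
  - lra.
  - by move=> p /andP[p1 _] /andP[p2 _]; apply: continuous_fixed_point_eqs; lra.
  - move=> t tI; have /andP[rr0 rr1] := radius lam t lam0 tI.
    rewrite /eqI /= /level subrr mul0r addr0 mulr1 subr_le0.
    by apply: N_le; [exact: fixed_point_step_gt0|lra].
  - move=> t tI; have /andP[rr0 rr1] := radius c1 t c10 tI.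
    rewrite /eqI /= subr_gt0.
    apply: (@lt_le_trans _ _ nu); last first.
      by apply: Nnu; [exact: fixed_point_step_bounds|exact/andP].
    apply: (@le_lt_trans _ _ (r1 * ((M + lam) / c1))).
      have L0 : 0 <= level c1.
        have := fixed_point_level_step c10; have := fixed_point_G_gt0 c10.
        have := fixed_point_step_gt0 c10 => s0 g0 e.
        by rewrite -(ler_pM2r s0) mul0r e ltW.
      by apply: ler_pM => //; [lra|exact: G_decay].
    have -> : r1 * ((M + lam) / c1) = r1 * (M + lam) / c1 by rewrite mulrA.
    rewrite ltr_pdivrMr// (_ : nu * c1 = nu * (lam + 1) + r1 * (M + lam)).
      by rewrite ltrDr mulr_gt0//; lra.
    by rewrite /c1; field; rewrite gt_eqF.
  - move=> c /andP[lc _]; have c0 : 0 < c by lra.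
    rewrite /eqII /= divff ?gt_eqF// subrr mul0r mulr0 subr0.
    have : 0 <= gap c * U (step c) (step c * Num.sqrt t0) by rewrite mulr_ge0 ?fixed_point_gap_ge0.
    have : sig2 * (ES * (lam / (M + lam)) ^+ 2) <= sig2 * mean c.
      by rewrite ler_pM2l// fixed_point_mean_lb.
    move: t00; rewrite /t0; lra.
  - move=> c /andP[lc _]; have c0 : 0 < c by lra.
    rewrite /eqII /= s1E /eqI /= s1E.
    have /andP[sl su] := fixed_point_step_bounds c0; have s0 := fixed_point_step_gt0 c0.
    set a := step c in sl su s0 *; set r := a * s1.
    have r_gt0 : 0 < r by rewrite mulr_gt0//; lra.
    pose th := 1 - t0 / t1.
    have q0 : 0 <= t0 / t1 by rewrite divr_ge0 ?ltW.
    have q1 : t0 / t1 <= 1 by rewrite ler_pdivrMr// mul1r ltW.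
    have Uc : U a r <= r * N a r + r * (1 + K) + K by apply: UK; [rewrite s0|exact: ltW].
    have Nr : N a r <= r by exact: N_le.
    have gc0 := fixed_point_gap_ge0 c0.
    have rr : r ^+ 2 = a ^+ 2 * t1 by rewrite exprMn.
    (* The correction cancels the share th of r N in the bound on [U] and puts th r^2 [level] in its
       place. The remaining share t0 / t1 costs at most (t0 / t1) r^2 = t0 a^2, which does not grow
       with t1. *)
    have h1 : gap c * U a r - gap c * (th * (r * (N a r - r * level c))) <=
        gap c * (t0 * a ^+ 2 + r * (1 + K) + K) + th * t1 * (gap c * (a ^+ 2 * level c)).
      have : t0 / t1 * (r * N a r) <= t0 * a ^+ 2.
        apply: (@le_trans _ _ (t0 / t1 * (r * r))).
          by rewrite ler_wpM2l// ler_pM2l.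
        rewrite -expr2 rr (_ : t0 / t1 * _ = t0 * a ^+ 2)//.
        by field; rewrite gt_eqF.
      move=> h; rewrite -mulrBr.
      rewrite (_ : th * t1 * _ = gap c * (th * (a ^+ 2 * t1 * level c))); last by ring.
      rewrite -mulrDr -rr; apply: ler_wpM2l => //; rewrite /th in h *.
      lra.
    have h2 : th * t1 * (gap c * (a ^+ 2 * level c)) <= t1 * (1 - kap).
      have L := fixed_point_gap_level c0; rewrite -/a -/kap in L.
      have k1 : 0 <= 1 - kap.
        by rewrite subr_ge0 ler_pdivrMr ?mul1r//; lra.
      apply: (@le_trans _ _ (th * t1 * (1 - kap))).
        by rewrite ler_wpM2l// mulr_ge0 ?(ltW t10)// subr_ge0.
      by rewrite ler_wpM2r// ler_piMl ?(ltW t10)// /th; lra.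
    have h3 : gap c * (t0 * a ^+ 2 + r * (1 + K) + K) <=
        V * (t0 / lam ^+ 2 + lam^-1 * s1 * (1 + K) + K).
      have K1 : 0 <= 1 + K by rewrite addr_ge0.
      have a2 : a ^+ 2 <= (lam ^+ 2)^-1.
        by rewrite -exprVn; apply: lerXn2r; rewrite ?nnegrE ?(ltW s0) ?(ltW lV).
      have rs : r * (1 + K) <= lam^-1 * s1 * (1 + K).
        by apply: ler_wpM2r => //; apply: ler_wpM2r => //; lra.
      have ta : t0 * a ^+ 2 <= t0 / lam ^+ 2 by rewrite ler_pM2l.
      apply: ler_pM => //; last by lra.
        have : 0 <= t0 * a ^+ 2 by rewrite mulr_ge0 ?sqr_ge0 ?(ltW t00).
        have : 0 <= r * (1 + K) by rewrite mulr_ge0 ?(ltW r_gt0).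
        lra.
      exact: fixed_point_gap_ub.
    have h4 : sig2 * mean c <= sig2 * M by rewrite ler_pM2l// fixed_point_mean_ub.
    have h5 : A + A' * s1 <= kap * t1.
      apply: (@le_trans _ _ ((A + A' + 1) * s1)).
        have As : A * 1 <= A * s1 by rewrite ler_wpM2l//; lra.
        lra.
      by rewrite /t1 expr2 mulrA ler_wpM2r//; lra.
    have h6 : V * (t0 / lam ^+ 2 + lam^-1 * s1 * (1 + K) + K) + sig2 * M = A + A' * s1.
      by rewrite /A /A'; ring.
    rewrite -/th; move: h1 h2 h3 h4 h5 h6; lra.
exists p.1, p.2; move/andP: p1 => [lp _]; move/andP: p2 => [tp _].
split; [lra|lra| |].
  by apply/eqP; rewrite -subr_eq0; apply/eqP.
by move: e2; rewrite /eqII e1 !mulr0 subr0 => /eqP; rewrite subr_eq0 => /eqP ->.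
Qed.

End FixedPointSystem.

(** * Back to the original parameters *)

(** The substitution is undone with eta = 1/g and gamma1 = gam. Because r (1 + (lam - c) g) =
    sqrt(t) g, the Bessel bound reads g^2 t <= u, which is tau2 >= 0; the equations are rational
    identities. *)
Lemma vamp_solution (R : realType) (lam sig2 c t g h u : R)
    (gam := g^-1 - c) (r := (lam + gam)^-1 * Num.sqrt t)
    (tau1 := t / gam ^+ 2) (tau2 := (u - g ^+ 2 * t) / (c * g) ^+ 2) :
    0 < lam -> 0 < c -> 0 < t -> 0 < g -> 0 < h -> c * g < 1 ->
    (r * (1 + (lam - c) * g)) ^+ 2 <= u ->
    t = sig2 * (g / h - c) + (g ^- 2 - h^-1) * u ->
  [/\ 0 < gam < g^-1, 0 <= tau1, 0 <= tau2 &
      gam / (lam + gam) * Num.sqrt tau1 = r] /\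
  [/\ gam / g^-1 = gam / (lam + gam) * (1 + (lam - c) * g),
      tau2 = (g^-1 / (g^-1 - gam)) ^+ 2 * (u - (gam / g^-1) ^+ 2 * tau1),
      gam / g^-1 = 1 - g^-1^-1 * c
    & tau1 = (g^-1 / gam) ^+ 2 *
        ((sig2 * (g - c * h) + (g^-1 - gam) ^+ 2 * tau2 * h)
         - ((g^-1 - gam) / g^-1) ^+ 2 * tau2)].
Proof.
move=> lam0 c0 t0 g0 h0 cg1 Nu tE.
have cg : g^-1 - gam = c by rewrite /gam; ring.
have gam0 : 0 < gam by rewrite subr_gt0 -(ltr_pM2r g0) mulVf ?gt_eqF.
have lg0 : 0 < lam + gam by rewrite addr_gt0.
have levelE : 1 + (lam - c) * g = (lam + gam) * g by rewrite /gam; field; rewrite gt_eqF.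
have rg : r * (1 + (lam - c) * g) = Num.sqrt t * g.
  by rewrite levelE /r; field; rewrite gt_eqF.
have gg : gam * g = 1 - c * g by rewrite /gam; field; rewrite gt_eqF.
split; split.
- by rewrite gam0 /= /gam gtrDl oppr_lt0.
- by rewrite divr_ge0 ?sqr_ge0 ?ltW.
- apply: divr_ge0; last exact: sqr_ge0.
  by move: Nu; rewrite rg exprMn sqr_sqrtr ?(ltW t0)// subr_ge0 mulrC.
- rewrite /tau1 sqrtrM ?(ltW t0)// sqrtrV ?sqr_ge0// sqrtr_sqr gtr0_norm// /r.
  by field; rewrite !gt_eqF.
- by rewrite levelE invrK; field; rewrite gt_eqF.
- by rewrite cg /tau2 /tau1 invrK; field; rewrite !gt_eqF.
- by rewrite !invrK gg mulrC.
(* The equation for t, multiplied by h, eliminates sig2. *)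
- have -> : sig2 * (g - c * h) = t * h - (h / g ^+ 2 - 1) * u.
    by rewrite tE; field; rewrite !gt_eqF.
  rewrite cg /tau2 invrK /tau1; move: gam0; rewrite -/gam => gam0.
  by field; rewrite !gt_eqF.
Qed.

(** * From a law supported on [0, M] to a bounded variable *)

Section Support.
Context {R : realType}.
Variables (mu : probability (measurableTypeR R) R) (M : R).
Hypothesis muM : mu [set` `[0, M]] = 1%E.

(** [mu] charges only [0, M], but the resolvent lemmas take a variable bounded at every point.
    Truncating the identity provides one without changing any integral against [mu]. *)
Definition clamp (s : R) : R := Num.max 0 (Num.min M s).

Lemma measurable_clamp : measurable_fun setT clamp.
Proof. by apply: measurable_maxr => //; apply: measurable_minr. Qed.

Lemma clamp_ge0 s : 0 <= clamp s.
Proof. by rewrite /clamp le_max lexx. Qed.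

Lemma clamp_id s : `[0, M]%classic s -> clamp s = s.
Proof.
by rewrite /= in_itv /= => /andP[s0 sM]; rewrite /clamp (min_r sM) (max_r s0).
Qed.

Lemma support_ge0 : 0 <= M.
Proof.
rewrite leNgt; apply/negP => M0; have := muM; rewrite set_itv_ge ?bnd_simp -?ltNge//.
by rewrite measure0 => /esym/eqP; rewrite onee_eq0.
Qed.

Lemma clamp_le s : clamp s <= M.
Proof. by rewrite /clamp ge_max support_ge0 ge_min lexx. Qed.

Lemma Rintegral_clamp (f : R -> R) : measurable_fun setT f ->
  \int[mu]_s f s = \int[mu]_s f (clamp s).
Proof.
move=> mf; congr fine; apply: ae_eq_integral => //.
- exact/measurable_EFinP.
- by apply/measurable_EFinP; exact: (measurableT_comp mf measurable_clamp).
exists (~` [set` `[0, M]]); split.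
- by apply: measurableC; exact: measurable_itv.
- have := @probability_setC _ _ _ mu _ (measurable_itv `[0, M]).
  by rewrite muM subee.
- move=> s /=; apply: contra_not => sM _.
  by rewrite clamp_id.
Qed.

End Support.

(** * The channel moments under the law of B and Z *)

Section GaussianChannel.
Context {R : realType}.
Variable pi : probability (measurableTypeR R) R.
Hypothesis pi2 : (\int[pi]_x ((x : R) ^+ 2)%:E < +oo)%E.
Variable h : R -> \bar R.
Hypothesis hcc : closed_convex h.
Notation Q := (pi \x normal_prob (0 : R) 1)%E.
Notation RR := (measurableTypeR R * measurableTypeR R)%type.

Definition gauss_corr : R -> R -> R := prox_corr Q (fun z : RR => z.1) (fun z : RR => z.2) h.
Definition gauss_mse : R -> R -> R := prox_mse Q (fun z : RR => z.1) (fun z : RR => z.2) h.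

Let mB : measurable_fun setT (fun z : RR => (z.1 : R)) := measurable_fst.
Let mZ : measurable_fun setT (fun z : RR => (z.2 : R)) := measurable_snd.
Let Q1 := product_normal_setT pi.
Let B2 := product_integrable_fst_sqr pi2.
Let Z2 := product_integrable_snd_sqr pi.

Let EZ2 : \int[Q]_z ((z.2 : R) ^+ 2) = 1.
Proof. by rewrite /Rintegral product_second_moment_snd. Qed.

Let EZf (f : R -> R) : {homo f : x y / x <= y} ->
  (forall x y, x <= y -> f y - f x <= y - x) -> \int[Q]_z (z.2 * f z.1) = 0.
Proof. exact: product_mul_snd_eq0. Qed.

Let ndp a : 0 < a -> {homo prox a h : x y / x <= y}.
Proof. by move=> a0 x y; exact: prox_homo. Qed.

Let lip a : 0 < a -> forall x y, x <= y -> prox a h y - prox a h x <= y - x.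
Proof. by move=> a0 x y; exact: prox_ler_sub. Qed.

Lemma gauss_corr_stein a r : 0 < a -> 0 <= r ->
  gauss_corr a r = r * E_BZ pi (fun B Z => prox' a h (B + r * Z)).
Proof. by move=> a0 r0; exact: (product_stein pi2 (ndp a0) (lip a0)). Qed.

Lemma gauss_corr_gt0 a r : (exists x1 x2, [/\ x1 != x2, (h x1 < +oo)%E & (h x2 < +oo)%E]) ->
  0 < a -> 0 < r -> 0 < gauss_corr a r.
Proof.
move=> hdom a0 r0; apply: (product_stein_gt0 pi2 (ndp a0) (lip a0)) => //.
exact: prox_nonconstant.
Qed.

Definition continuous_gauss_corr := continuous_prox_corr mB mZ Q1 B2 Z2 hcc.
Definition continuous_gauss_mse := continuous_prox_mse mB mZ Q1 B2 Z2 hcc.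
Definition gauss_corr_le := prox_corr_le mB mZ Q1 B2 Z2 EZ2 EZf hcc.
Definition gauss_corr_sqr_le := prox_corr_sqr_le mB mZ Q1 B2 Z2 EZ2 EZf hcc.
Definition gauss_mse_le := prox_mse_le mB mZ Q1 B2 Z2 EZ2 EZf hcc.

Lemma gauss_mse_ge0 a r : 0 <= gauss_mse a r.
Proof. by apply: Rintegral_ge0 => z _; exact: sqr_ge0. Qed.

End GaussianChannel.

Theorem lemma3p2 (R : realType) (d : measure_display) (T : measurableType d)
    (P : probability T R)
    (* the linear model *)
    (n : nat -> nat) (delta : R) (sigma2 : R)
    (X : forall p, T -> 'M[R]_(n p, p)) (y : forall p, T -> 'cV[R]_(n p))
    (betas : forall p, T -> 'cV[R]_p) (eps : forall p, T -> 'cV[R]_(n p))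
    (U : forall p, T -> 'M[R]_(n p)) (Sigma : forall p, T -> 'M[R]_(n p, p))
    (V : forall p, T -> 'M[R]_p) (s : forall p, T -> 'I_p -> R)
    (mu pi : probability (measurableTypeR R) R) (h : R -> \bar R)
    (hdelta : 0 < delta)
    (hn : (fun p => (n p)%:R / p%:R : R) @ \oo --> delta)
    (hy : forall p w, y p w = X p w *m betas p w + eps p w)
    (* rotationally invariant design *)
    (hU : forall p, random_mx (U p)) (hSigma : forall p, random_mx (Sigma p))
    (hbetas : forall p, random_mx (betas p))
    (hX : forall p w, X p w = U p w *m Sigma p w *m (V p w)^T)
    (hUorth : forall p w, orthogonal_mx (U p w))
    (hSigmadiag : forall p w, svd_diagonal (Sigma p w))
    (hVhaar : forall p, haar_distributed P (V p))
    (hVindep : forall p, independent P (sigma_mx (V p))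
       <<s sigma_mx (U p) `|` sigma_mx (Sigma p) `|` sigma_mx (betas p) >>)
    (hs : forall p w, eigenvalues_of ((X p w)^T *m X p w) (s p w))
    (hsW2 : {ae P, forall w,
       (fun p => wasserstein2 (empirical (s p w)) mu) @ \oo --> 0%E})
    (hmusupp : exists M : R, mu [set` `[0, M]] = 1%E)
    (hmupos : 0 < \int[mu]_x (x : R))
    (hsbound : {ae P, forall w,
       (limn_esup (fun p => \big[maxe/-oo]_(i < p) (s p w i)%:E) < +oo)%E})
    (* Gaussian noise *)
    (hsigma2 : 0 < sigma2)
    (heps : forall p, isotropic_gaussian P sigma2 (eps p))
    (hepsindep : forall p, independent P (sigma_mx (eps p))
       <<s sigma_mx (U p) `|` sigma_mx (Sigma p) `|` sigma_mx (V p)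
           `|` sigma_mx (betas p) >>)
    (* signal *)
    (hbetasW2 : {ae P, forall w,
       (fun p => wasserstein2 (empirical (fun j => betas p w j 0)) pi) @ \oo
         --> 0%E})
    (hpi2 : (\int[pi]_x ((x : R) ^+ 2)%:E < +oo)%E)
    (* penalty *)
    (hproper : proper_efun h) (hlsc : lower_semicontinuous h)
    (hnonconst : ~ (exists c, forall x, h x = c)) (hconvex : econvex h)
    (hmin : forall p, {ae P, forall w, exists b : 'cV[R]_p, forall b',
       (penalized_loss h (X p w) (y p w) b
          <= penalized_loss h (X p w) (y p w) b')%E})
    (hdom : exists x1 x2 : R, [/\ x1 != x2, (h x1 < +oo)%E & (h x2 < +oo)%E]) :
  forall lambda : R, 0 < lambda ->
  exists gamma1 eta tau1 tau2 : R,
    [/\ 0 < gamma1 < eta, 0 <= tau1 & 0 <= tau2] /\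
    [/\ gamma1 / eta =
          gamma1 / (lambda + gamma1) *
          E_BZ pi (fun B Z =>
            prox' (lambda + gamma1)^-1 h
              (B + gamma1 / (lambda + gamma1) * Num.sqrt tau1 * Z)),
        tau2 =
          (eta / (eta - gamma1)) ^+ 2 *
          (E_BZ pi (fun B Z =>
             (prox (lambda + gamma1)^-1 h
                (B + gamma1 / (lambda + gamma1) * Num.sqrt tau1 * Z) - B) ^+ 2)
           - (gamma1 / eta) ^+ 2 * tau1),
        gamma1 / eta = 1 - eta^-1 * Ginv mu eta^-1
      & tau1 =
          (eta / gamma1) ^+ 2 *
          (\int[mu]_S ((sigma2 * (S : R) + (eta - gamma1) ^+ 2 * tau2)
                        / ((S : R) + eta - gamma1) ^+ 2)
           - ((eta - gamma1) / eta) ^+ 2 * tau2)].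
Proof.
move=> lam lam0; have [M muM] := hmusupp.
have hcc : closed_convex h by split.
have M0 := support_ge0 muM.
pose C : measurableTypeR R -> R := clamp M.
have mC : measurable_fun setT C := measurable_clamp M.
have C0 s' : 0 <= C s' := clamp_ge0 M s'.
have CM s' : C s' <= M := clamp_le muM s'.
have EC : 0 < \int[mu]_x C x by have := hmupos; rewrite (Rintegral_clamp muM (f := id)).
have GE c : G mu c = stieltjes mu C c.
  rewrite /G (Rintegral_clamp muM (f := fun s => (s + c)^-1))//.
  by apply: (measurableT_comp (@measurable_inv R)); exact: measurable_funD.
have G0 := stieltjes_gt0 mu mC C0 CM; have H0 := stieltjes2_gt0 mu mC C0 CM.
have cG1 := stieltjes_mul_lt1 mC C0 CM EC.
have [c [t [c0 t0 NE tE]]] := fixed_point_system_solvable M0 lam0 hsigma2 EC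
  (continuous_stieltjes mC C0) (continuous_stieltjes2 mC C0)
  (stieltjes_lb mu mC C0 CM) cG1
  (stieltjes2_lb mu mC C0 CM) (stieltjes2_ub mu mC C0)
  (stieltjes_sqr_le mu mC C0) (stieltjes_variance_le mu mC C0 CM)
  (stieltjes_resolvent_lb mu mC C0 CM) (stieltjes_resolvent_ub mu mC C0 CM)
  (fun c c0 => stieltjes_affine_le mu mC C0 CM c0 lam0)
  (continuous_gauss_corr hpi2 hcc) (continuous_gauss_mse hpi2 hcc)
  (gauss_corr_le hpi2 hcc) (fun a r => gauss_corr_gt0 hpi2 hcc hdom)
  (gauss_mse_ge0 pi h) (gauss_mse_le hpi2 hcc).
move: NE tE => /=; set g := stieltjes mu C c; set h2 := stieltjes2 mu C c.
set gam := g^-1 - c; set a := (lam + gam)^-1; set r := a * Num.sqrt t.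
set u := gauss_mse pi h a r => NE tE.
have g0 : 0 < g := G0 c c0; have cg1 : c * g < 1 := cG1 c c0.
have gam0 : 0 < gam by rewrite subr_gt0 -(ltr_pM2r g0) mulVf ?gt_eqF.
have a0 : 0 < a by rewrite invr_gt0 addr_gt0.
have r0 : 0 < r by rewrite mulr_gt0// sqrtr_gt0.
have Nu : (r * (1 + (lam - c) * g)) ^+ 2 <= u.
  by rewrite -NE; exact: (gauss_corr_sqr_le hpi2 hcc).
have := vamp_solution lam0 c0 t0 g0 (H0 c c0) cg1 Nu tE.
rewrite -/gam -/h2.
set tau1 := t / gam ^+ 2; set tau2 := (u - g ^+ 2 * t) / (c * g) ^+ 2.
move=> [[gameta tau10 tau20 rE] [e1 e2 e3 e4]].
exists gam, g^-1, tau1, tau2; split; first by split.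
split.
(* The reduced first equation is r times the wanted one by integration by parts, and r > 0 can be
   cancelled. *)
- rewrite rE e1; congr (_ * _); apply: (mulfI (lt0r_neq0 r0)).
  by rewrite -(gauss_corr_stein hpi2 hcc a0 (ltW r0)); exact/esym/NE.
- by rewrite rE.
(* [Ginv] chooses some preimage of G(c): c itself rules out the default branch, and strict
   monotonicity identifies the choice with c. *)
- rewrite e3; congr (_ - _ * _); rewrite /Ginv invrK.
  case: xgetP => [c' _ [c'0]|/(_ c)[]]; last by split => //; rewrite GE.
  rewrite GE => gE; case: (ltgtP c c') => // cc'.
  + by have := stieltjes_decreasing mu mC C0 CM c0 cc'; rewrite gE ltxx.
  + by have := stieltjes_decreasing mu mC C0 CM c'0 cc'; rewrite gE ltxx.
- rewrite {1}e4; congr (_ * (_ - _)).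
  have -> : g^-1 - gam = c by rewrite /gam; ring.
  set k := c ^+ 2 * tau2.
  rewrite (Rintegral_clamp muM (f := fun x => (sigma2 * x + k) / (x + g^-1 - gam) ^+ 2)).
    rewrite -/C -(Rintegral_affine_resolvent mu mC C0 CM)//.
    apply: eq_Rintegral => x _; congr (_ / _ ^+ 2); rewrite /gam; ring.
  apply: measurable_funM; first by apply: measurable_funD => //; exact: measurable_funM.
  apply: (measurableT_comp (@measurable_inv R)); apply: measurable_funX.
  by apply: measurable_funB => //; exact: measurable_funD.
Qed.
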